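(* Let $M$ be a universal semi-POVM. Then there exist constants $c\ge 0$ and $c'>0$ such that for every density matrix $\rho\in\mathrm{Her}(N)$ and every $s\in\Sigma^*$: $$\bigl|K(s)+\log_2\operatorname{tr}(\rho M(s))\bigr|\le c,$$ and $$c'\,P(s)\le\operatorname{tr}(\rho M(s)),\qquad c'\,\operatorname{tr}(\rho M(s))\le P(s).$$
   Context: $N$ is a fixed positive integer; $\Sigma^*$ is the set of finite binary strings. $\mathrm{Her}(N)$ is the set of $N\times N$ Hermitian matrices and $\mathrm{Her}_Q(N)$ those with entries in $\{a+ib:a,b\in\mathbb{Q}\}$; $A\leqslant B$ means $B-A$ is positive semi-definite. A density matrix is $\rho\in\mathrm{Her}(N)$, $0\leqslant\rho$, $\operatorname{tr}\rho=1$. A semi-POVM on $\Sigma^*$ is a map $R:\Sigma^*\to\mathrm{Her}(N)$ with $0\leqslant R(s)$ for all $s$ and $\sum_s R(s)\leqslant I$. A lower-computable semi-POVM is a semi-POVM $R$ for which there is a total recursive $f:\mathbb{N}\times\Sigma^*\to\mathrm{Her}_Q(N)$ with $\lim_{n}f(n,s)=R(s)$ and $f(n,s)\leqslant R(s)$ for all $n,s$. A universal semi-POVM is a lower-computable semi-POVM $M$ such that for every lower-computable semi-POVM $R$ there is $c>0$ with $c\,R(s)\leqslant M(s)$ for all $s\in\Sigma^*$. A computer is a partial recursive function $C:\Sigma^*\to\Sigma^*$ with prefix-free domain; a computer $U$ is optimal if for every computer $C$ there is a constant $\mathrm{sim}(C)$ such that whenever $C(p)$ is defined there is $p'$ with $U(p')=C(p)$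 and $|p'|\le|p|+\mathrm{sim}(C)$. Fix an optimal computer $U$; $K(s)=\min\{|p|:U(p)=s\}$ and $P(s)=\sum_{U(p)=s}2^{-|p|}$. *)

(* Defs.v *)
(* Complex numbers: mathcomp-real-closed's R[i]. *)
From HB Require Import structures.
From mathcomp Require Import all_boot all_order all_algebra.
From mathcomp Require Import complex spectral.
From mathcomp Require Import all_classical all_reals all_analysis.

Set Implicit Arguments.
Unset Strict Implicit.
Unset Printing Implicit Defensive.

Import Order.TTheory GRing.Theory Num.Theory.
Import numFieldNormedType.Exports.
Local Open Scope ring_scope.

(* 1. Partial recursive functions (mu-recursive functions on nat).     *)

(* Codes of mu-recursive functions; arguments are passed as a list.   *)
Inductive recf : Type :=
| RZero                            (* constant 0                      *)
| RSucc                            (* successor of the first argument *)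
| RProj (i : nat)                  (* i-th argument (0-based)         *)
| RComp (f : recf) (gs : seq recf) (* f (g_1 xs, ..., g_k xs)         *)
| RPrec (f g : recf)               (* primitive recursion, 1st arg    *)
| RMin (f : recf).                 (* mu-operator on the 1st argument *)

(* Big-step semantics: [eval e xs y] means e halts on xs with output y. *)
Inductive eval : recf -> seq nat -> nat -> Prop :=
| eZero xs : eval RZero xs 0
| eSucc x xs : eval RSucc (x :: xs) x.+1
| eProj i xs : (i < size xs)%N -> eval (RProj i) xs (nth 0%N xs i)
| eComp f gs xs ys y : evals gs xs ys -> eval f ys y -> eval (RComp f gs) xs y
| ePrec0 f g xs y : eval f xs y -> eval (RPrec f g) (0%N :: xs) y
| ePrecS f g n xs r y :
    eval (RPrec f g) (n :: xs) r -> eval g (n :: r :: xs) y ->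
    eval (RPrec f g) (n.+1 :: xs) y
| eMin f xs n :
    eval f (n :: xs) 0 ->
    (forall m, (m < n)%N -> exists k, eval f (m :: xs) k.+1) ->
    eval (RMin f) xs n
with evals : seq recf -> seq nat -> seq nat -> Prop :=
| esNil xs : evals [::] xs [::]
| esCons g gs xs y ys : eval g xs y -> evals gs xs ys -> evals (g :: gs) xs (y :: ys).

(* Finite binary strings Sigma^* = seq bool, coded in nat by [pickle]. *)
Definition bstring := seq bool.

(* A partial function Sigma^* -> Sigma^* is partial recursive. *)
Definition partial_recursive (C : bstring -> option bstring) : Prop :=
  exists e : recf, forall (s : bstring) (y : nat),
    eval e [:: pickle s] y <-> exists t, C s = Some t /\ y = pickle t.

(* A computer: partial recursive with prefix-free domain. *)
Definition prefix_free_dom (C : bstring -> option bstring) : Prop :=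
  forall p q : bstring, C p <> None -> C q <> None -> prefix p q -> p = q.

Definition computer (C : bstring -> option bstring) : Prop :=
  partial_recursive C /\ prefix_free_dom C.

(* Optimal computer. *)
Definition optimal (U : bstring -> option bstring) : Prop :=
  computer U /\
  forall C, computer C -> exists sim : nat,
    forall p t, C p = Some t ->
      exists p', U p' = Some t /\ (size p' <= size p + sim)%N.

(* Prefix complexity K(s) = min { |p| : U p = s } (0 if no program). *)
Definition has_prog_of_size (U : bstring -> option bstring) (s : bstring) : pred nat :=
  fun n => `[< exists p : bstring, size p = n /\ U p = Some s >].

Definition Kc (U : bstring -> option bstring) (s : bstring) : nat :=
  match pselect (exists n, has_prog_of_size U s n) with
  | left H => ex_minn H
  | right _ => 0%N
  end.

(* Algorithmic probability P(s) = sum_{U p = s} 2^{-|p|}. *)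
Definition Pu (R : realType) (U : bstring -> option bstring) (s : bstring) : R :=
  fine (\esum_(p in [set p : bstring | U p = Some s]) ((2 : R) ^- size p)%:E)%E.

(* 2. Hermitian matrices over C = R[i] and the Loewner order.          *)

Local Open Scope sesquilinear_scope.

Definition hermitian (R : realType) (N : nat) (A : 'M[R[i]]_N) : Prop :=
  A ^t* = A.

Definition psd (R : realType) (N : nat) (A : 'M[R[i]]_N) : Prop :=
  hermitian A /\ forall v : 'rV[R[i]]_N, 0 <= (v *m A *m v ^t*) 0 0.

(* A <= B  iff  B - A is positive semi-definite *)
Definition loewner (R : realType) (N : nat) (A B : 'M[R[i]]_N) : Prop :=
  psd (B - A).

Definition density (R : realType) (N : nat) (rho : 'M[R[i]]_N) : Prop :=
  hermitian rho /\ psd rho /\ \tr rho = 1.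

(* Her_Q(N): a matrix with Gaussian rational entries, coded by the pair
   (real part, imaginary part) of rational matrices. *)
Definition gaussQ (N : nat) := ('M[rat]_N * 'M[rat]_N)%type.

Definition toC (R : realType) (N : nat) (A : gaussQ N) : 'M[R[i]]_N :=
  \matrix_(i, j) (Complex (ratr (A.1 i j)) (ratr (A.2 i j)) : R[i]).

(* Total recursive f : N x Sigma^* -> Her_Q(N). *)
Definition total_recursive2 (N : nat) (f : nat -> bstring -> gaussQ N) : Prop :=
  exists e : recf, forall n s, eval e [:: n; pickle s] (pickle (f n s)).

(* Semi-POVM: R(s) >= 0 and sum_s R(s) <= I (sum of PSD terms, i.e. all
   finite partial sums are <= I). *)
Definition semiPOVM (R : realType) (N : nat) (Rm : bstring -> 'M[R[i]]_N) : Prop :=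
  (forall s, loewner 0 (Rm s)) /\
  (forall S : seq bstring, uniq S -> loewner (\sum_(s <- S) Rm s) 1%:M).

(* entrywise convergence of a sequence of complex matrices *)
Definition mx_cvg (R : realType) (N : nat) (u : nat -> 'M[R[i]]_N) (l : 'M[R[i]]_N) : Prop :=
  forall i j,
    ((fun n => complex.Re (u n i j)) @ \oo --> complex.Re (l i j))%classic /\
    ((fun n => complex.Im (u n i j)) @ \oo --> complex.Im (l i j))%classic.

Definition lower_computable (R : realType) (N : nat) (Rm : bstring -> 'M[R[i]]_N) : Prop :=
  semiPOVM Rm /\
  exists f : nat -> bstring -> gaussQ N,
    total_recursive2 f /\
    (forall n s, hermitian (toC R (f n s))) /\
    (forall s, mx_cvg (fun n => toC R (f n s)) (Rm s)) /\
    (forall n s, loewner (toC R (f n s)) (Rm s)).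

Definition universal (R : realType) (N : nat) (M : bstring -> 'M[R[i]]_N) : Prop :=
  lower_computable M /\
  forall Rm : bstring -> 'M[R[i]]_N, lower_computable Rm ->
    exists c : R, 0 < c /\ forall s, loewner ((c%:C)%C *: Rm s) (M s).

Definition log2 (R : realType) (x : R) : R := ln x / ln 2.

(* Main.v *)
Require Import Defs.
From HB Require Import structures.
From mathcomp Require Import all_boot all_order all_algebra.
From mathcomp Require Import complex spectral zify ring lra.
From mathcomp Require Import all_classical all_reals all_analysis.

Set Implicit Arguments.
Unset Strict Implicit.
Unset Printing Implicit Defensive.

Import Order.TTheory GRing.Theory Num.Theory.
Import numFieldNormedType.Exports.

(** Three comparisons, each up to a multiplicative constant, close the circle
    [P(s) <~ tr(rho M(s)) <~ 2^-K(s) <= P(s)].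

    - [P(s) I] is a lower-computable semi-POVM: the domain of [U] satisfies
      Kraft's inequality, and [P(s)] is the limit from below of the dyadic sums
      over the programs found within [n] steps.  Universality of [M] gives
      [a P(s) I <= M(s)], hence [a P(s) <= tr(rho M(s))].

    - [tr(rho M(s)) <= tr M(s)], and every diagonal entry of [M] is a
      lower-computable semi-measure [m].  Request a word of length about [k]
      for [s] as soon as [2^-k < m(s)] is observed; for fixed [s] the requests
      have total weight at most [m(s)], so all of them fit into the unit
      interval as consecutive intervals, and a dyadic interval chosen inside
      each yields a prefix-free machine.  By optimality [U] has programs of
      essentially the same length, i.e. [m(s) <~ 2^-K(s)].

    - A shortest program of [s] contributes [2^-K(s)] to [P(s)]. *)

(* [all_analysis] has its own [eval]. *)
Local Notation eval := Defs.eval.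

(** * Computable functions *)

Fixpoint All (T : Type) (P : T -> Prop) (s : seq T) : Prop :=
  if s is x :: s' then P x /\ All P s' else True.

Lemma All_map (T T' : Type) (P : T' -> Prop) (f : T -> T') (s : seq T) :
  All P (map f s) <-> All (fun x => P (f x)) s.
Proof. by elim: s => //= x s ->. Qed.

Lemma All_impl (T : Type) (P Q : T -> Prop) (s : seq T) :
  (forall x, P x -> Q x) -> All P s -> All Q s.
Proof. by move=> PQ; elim: s => //= x s IH [/PQ ? /IH]. Qed.

Lemma All_seq (T : eqType) (P : T -> Prop) (s : seq T) :
  {in s, forall x, P x} -> All P s.
Proof.
elim: s => //= x s IH Ps; split; first exact/Ps/mem_head.
by apply: IH => y ys; apply: Ps; rewrite inE ys orbT.
Qed.

(* The automatically generated principle ignores the codes nested in [RComp]. *)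
Lemma recf_nested_ind (P : recf -> Prop) :
  P RZero -> P RSucc -> (forall i, P (RProj i)) ->
  (forall f gs, P f -> All P gs -> P (RComp f gs)) ->
  (forall f g, P f -> P g -> P (RPrec f g)) ->
  (forall f, P f -> P (RMin f)) -> forall e, P e.
Proof.
move=> HZ HS HP HC HR HM; fix IH 1 => -[||i|f gs|f g|f].
- exact: HZ.
- exact: HS.
- exact: HP.
- apply: HC; first exact: IH.
  by elim: gs => [//|g gs IHgs]; split; [apply: IH|apply: IHgs].
- by apply: HR; apply: IH.
- by apply: HM; apply: IH.
Qed.

(** The argument [j] is written [nth 0 xs j], so a computable function is an ordinary term in [xs]
    and its computability proof follows the syntax of that term. *)
Definition computable (k : nat) (F : seq nat -> nat) : Prop :=
  exists e, forall xs, size xs = k -> eval e xs (F xs).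

Lemma computable_ext k F G :
  (forall xs, size xs = k -> G xs = F xs) -> computable k F -> computable k G.
Proof. by move=> FG [e He]; exists e => xs sz; rewrite FG //; apply: He. Qed.

Lemma computable_var_eq k V j :
  (forall xs, V xs = nth 0 xs j) -> j < k -> computable k V.
Proof.
move=> Vj jk; exists (RProj j) => xs sz; rewrite Vj; apply: eProj.
by rewrite sz.
Qed.

Lemma computable_var k j : j < k -> computable k (fun xs => nth 0 xs j).
Proof. exact: computable_var_eq. Qed.

(* [eval e] need only be defined on the arguments that actually occur. *)
Lemma computable_run k e Gs F :
  All (computable k) Gs ->
  (forall xs, size xs = k -> eval e [seq G xs | G <- Gs] (F xs)) ->
  computable k F.
Proof.
move=> cG He.
have [es Hes] : exists es, forall xs, size xs = k ->
    evals es xs [seq G xs | G <- Gs].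
  elim: {He} Gs cG => [_|G Gs IH /= [[g Hg] /IH[gs Hgs]]].
    by exists [::] => xs _; exact: esNil.
  by exists (g :: gs) => xs sz; apply: esCons; [apply: Hg|apply: Hgs].
by exists (RComp e es) => xs sz; apply: (eComp (Hes _ sz)); exact: He.
Qed.

Lemma computable_subst k F Gs :
  computable (size Gs) F -> All (computable k) Gs ->
  computable k (fun xs => F [seq G xs | G <- Gs]).
Proof.
move=> [e He] cG; apply: (computable_run (e := e) cG) => xs _.
by apply: He; rewrite size_map.
Qed.

Lemma computable_succ k G : computable k G -> computable k (fun xs => (G xs).+1).
Proof.
move=> cG; have := @computable_subst k (fun xs => (nth 0 xs 0).+1) [:: G].
apply=> //; exists RSucc => -[|x []] //= _; exact: eSucc.
Qed.

Lemma computable_const k c : computable k (fun=> c).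
Proof.
elim: c => [|c IH]; last exact: computable_succ.
by exists RZero => xs _; exact: eZero.
Qed.

Lemma computable_apply1 k f G : computable 1 (fun xs => f (nth 0 xs 0)) ->
  computable k G -> computable k (fun xs => f (G xs)).
Proof. by move=> cf cG; exact: (@computable_subst k _ [:: G] cf). Qed.

Lemma computable_apply2 k f G H :
  computable 2 (fun xs => f (nth 0 xs 0) (nth 0 xs 1)) ->
  computable k G -> computable k H -> computable k (fun xs => f (G xs) (H xs)).
Proof. by move=> cf cG cH; exact: (@computable_subst k _ [:: G; H] cf). Qed.

Lemma computable_prec k B S :
  computable k B -> computable k.+2 S ->
  computable k.+1 (fun xs => nat_rect (fun=> nat) (B (behead xs))
    (fun m r => S [:: m, r & behead xs]) (head 0 xs)).
Proof.
move=> [b Hb] [s Hs]; exists (RPrec b s) => -[//|n xs] /= [sz].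
elim: n => [|n IH] /=; first by apply: ePrec0; exact: Hb.
by apply: ePrecS IH _; apply: Hs; rewrite /= sz.
Qed.

(* [nth _ _ 0] is the recursion index and [nth _ _ 1] the previous value. *)
Lemma computable_rec k B S n :
  computable k B ->
  computable k.+2
    (fun ys => S (nth 0 ys 0) (nth 0 ys 1) (behead (behead ys))) ->
  computable k n ->
  computable k (fun xs =>
    nat_rect (fun=> nat) (B xs) (fun m r => S m r xs) (n xs)).
Proof.
move=> cB cS cn; have := computable_prec cB cS; move=> cP.
(* The recursion is run on [n xs :: xs]; the tail is rebuilt from the [k] projections. *)
have := @computable_subst k _ (n :: [seq (fun xs => nth 0 xs i) | i <- iota 0 k]).
rewrite /= size_map size_iota => /(_ _ cP) cR.
apply: computable_ext (cR _) => /= [xs sz|].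
  by rewrite -map_comp /comp -sz -/(mkseq _ _) mkseq_nth.
split=> //; apply/All_map/All_seq => i; rewrite mem_iota add0n => ik.
exact: computable_var.
Qed.

Create HintDb comp.
#[global] Hint Resolve computable_succ computable_const : comp.
(* Inside a recursion or a bounded sum the parameters sit behind [behead]; [nth_behead] turns them
   back into plain projections. *)
#[global] Hint Extern 2 (computable _ (fun _ => nth _ _ _)) =>
  (eapply computable_var_eq;
   [ intro; rewrite ?nth_behead; reflexivity | reflexivity ]) : comp.

Ltac comp := auto 200 with comp nocore.

Lemma computable_pred k G : computable k G -> computable k (fun xs => (G xs).-1).
Proof.
apply: computable_apply1.
apply: (computable_ext (F := fun xs =>
  nat_rect (fun=> nat) 0 (fun m _ => m) (nth 0 xs 0))).
  by move=> xs _; case: (nth _ _ _).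
by apply: (@computable_rec 1 (fun=> 0) (fun m _ _ => m)); comp.
Qed.
#[global] Hint Resolve computable_pred : comp.

Lemma computable_add k G H : computable k G -> computable k H ->
  computable k (fun xs => G xs + H xs).
Proof.
apply: computable_apply2.
apply: (computable_ext (F := fun xs =>
  nat_rect (fun=> nat) (nth 0 xs 1) (fun _ r => r.+1) (nth 0 xs 0))).
  by move=> xs _; elim: (nth 0 xs 0) => //= m <-; rewrite addSn.
by apply: (@computable_rec 2 (fun xs => nth 0 xs 1) (fun _ r _ => r.+1)); comp.
Qed.
#[global] Hint Resolve computable_add : comp.

Lemma computable_mul k G H : computable k G -> computable k H ->
  computable k (fun xs => G xs * H xs).
Proof.
apply: computable_apply2.
apply: (computable_ext (F := fun xs =>
  nat_rect (fun=> nat) 0 (fun _ r => nth 0 xs 1 + r) (nth 0 xs 0))).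
  by move=> xs _; elim: (nth 0 xs 0) => //= m <-; rewrite mulSn.
by apply: (@computable_rec 2 (fun=> 0) (fun _ r xs => nth 0 xs 1 + r)); comp.
Qed.
#[global] Hint Resolve computable_mul : comp.

Lemma computable_sub k G H : computable k G -> computable k H ->
  computable k (fun xs => G xs - H xs).
Proof.
apply: computable_apply2.
apply: (computable_ext (F := fun xs =>
  nat_rect (fun=> nat) (nth 0 xs 0) (fun _ r => r.-1) (nth 0 xs 1))).
  by move=> xs _; elim: (nth 0 xs 1) => [|m /= <-]; rewrite ?subn0 // subnS.
by apply: (@computable_rec 2 (fun xs => nth 0 xs 0) (fun _ r _ => r.-1)); comp.
Qed.
#[global] Hint Resolve computable_sub : comp.

Lemma computable_exp k G H : computable k G -> computable k H ->
  computable k (fun xs => G xs ^ H xs).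
Proof.
apply: computable_apply2.
apply: (computable_ext (F := fun xs =>
  nat_rect (fun=> nat) 1 (fun _ r => nth 0 xs 0 * r) (nth 0 xs 1))).
  by move=> xs _; elim: (nth 0 xs 1) => //= m <-; rewrite expnS.
by apply: (@computable_rec 2 (fun=> 1) (fun _ r xs => nth 0 xs 0 * r)); comp.
Qed.
#[global] Hint Resolve computable_exp : comp.

(** * Decidable tests and bounded arithmetic *)

Definition decides (k : nat) (b : seq nat -> bool) : Prop :=
  computable k (fun xs => nat_of_bool (b xs)).

Lemma decides_ext k b c :
  (forall xs, size xs = k -> b xs = c xs) -> decides k c -> decides k b.
Proof. by move=> bc; apply: computable_ext => xs sz; rewrite bc. Qed.

Lemma computable_nat_of_bool k b :
  decides k b -> computable k (fun xs => nat_of_bool (b xs)).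
Proof. by []. Qed.
#[global] Hint Resolve computable_nat_of_bool : comp.

Lemma decides_leq k G H : computable k G -> computable k H ->
  decides k (fun xs => G xs <= H xs).
Proof.
move=> cG cH; apply: (computable_ext (F := fun xs => 1 - (G xs - H xs))).
  by move=> xs _; rewrite /leq; case: (_ - _).
by comp.
Qed.
#[global] Hint Resolve decides_leq : comp.

Lemma decides_and k b c : decides k b -> decides k c ->
  decides k (fun xs => b xs && c xs).
Proof.
move=> db dc; apply: (computable_ext (F := fun xs => b xs * c xs)).
  by move=> xs _; rewrite mulnb.
by comp.
Qed.
#[global] Hint Resolve decides_and : comp.

Lemma decides_neg k b : decides k b -> decides k (fun xs => ~~ b xs).
Proof.
move=> db; apply: (computable_ext (F := fun xs => 1 - b xs)).
  by move=> xs _; case: (b xs).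
by comp.
Qed.
#[global] Hint Resolve decides_neg : comp.

Lemma decides_eq k G H : computable k G -> computable k H ->
  decides k (fun xs => G xs == H xs).
Proof.
move=> cG cH; apply: (decides_ext (c := fun xs =>
  (G xs <= H xs) && (H xs <= G xs))).
  by move=> xs _; rewrite eqn_leq.
by comp.
Qed.
#[global] Hint Resolve decides_eq : comp.

Lemma computable_if k b G H : decides k b -> computable k G -> computable k H ->
  computable k (fun xs => if b xs then G xs else H xs).
Proof.
move=> db cG cH; apply: (computable_ext (F := fun xs =>
  b xs * G xs + (1 - b xs) * H xs)).
  by move=> xs _; case: (b xs); rewrite ?mul1n ?mul0n ?addn0.
by comp.
Qed.
#[global] Hint Resolve computable_if : comp.

Lemma computable_sum k f n :
  computable k.+1 (fun ys => f (nth 0 ys 0) (behead ys)) ->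
  computable k n -> computable k (fun xs => \sum_(i < n xs) f i xs).
Proof.
move=> cf cn; apply: (computable_ext (F := fun xs =>
  nat_rect (fun=> nat) 0 (fun m r => r + f m xs) (n xs))).
  move=> xs _; elim: (n xs) => [|m IH] /=; first by rewrite big_ord0.
  by rewrite big_ord_recr /= IH.
apply: (@computable_rec k (fun=> 0) (fun m r xs => r + f m xs)) => //; comp.
apply: computable_add; first by comp.
have := @computable_subst k.+2 _ ((fun xs => nth 0 xs 0) ::
   [seq (fun xs => nth 0 xs i) | i <- iota 2 k]).
rewrite /= size_map size_iota => /(_ _ cf) cR.
apply: computable_ext (cR _) => /= [[|a[|b xs]] //= [sz]|].
  congr f; rewrite -map_comp /comp -sz -[LHS](mkseq_nth 0) /mkseq (iotaDl 2 0).
  by rewrite -map_comp.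
split=> //; first by comp.
apply/All_map/All_seq => i; rewrite mem_iota => ik.
by apply: computable_var; lia.
Qed.

Lemma decides_all_below k b n :
  decides k.+1 (fun ys => b (nth 0 ys 0) (behead ys)) ->
  computable k n ->
  decides k (fun xs => [forall i : 'I_(n xs), b i xs]).
Proof.
move=> db cn; apply: (decides_ext (c := fun xs =>
  \sum_(i < n xs) ~~ b i xs == 0)); last first.
  apply: decides_eq; last by comp.
  by apply: (@computable_sum k (fun i xs => ~~ b i xs)) => //; comp.
move=> xs _; rewrite sum_nat_eq0; apply: eq_forallb => i.
by case: (b _ _).
Qed.

(** Lets a number be computed by counting the indices that pass a monotone decidable test: quotients
    in [computable_div], exponents of 2 in [chead_code]. *)
Lemma sum_ltn n m : m <= n -> \sum_(i < n) (i < m) = m.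
Proof.
move=> mn; rewrite -(big_mkord xpredT (fun i => nat_of_bool (i < m))).
rewrite (@big_cat_nat _ _ _ m) //= [X in _ + X]big1_seq ?addn0; last first.
  by move=> i; rewrite mem_index_iota /= => ?; lia.
rewrite (eq_big_nat _ _ (F2 := fun=> 1)) => [|i /andP[_ ->] //].
by rewrite sum_nat_const_nat subn0 muln1.
Qed.

Lemma computable_div k G H : computable k G -> computable k H ->
  computable k (fun xs => G xs %/ H xs).
Proof.
apply: (@computable_apply2 _ divn).
apply: (computable_ext (F := fun xs => \sum_(i < nth 0 xs 0)
   ((0 < nth 0 xs 1) && (nth 0 xs 1 * i.+1 <= nth 0 xs 0)))); last first.
  apply: (@computable_sum 2 (fun i xs => 
    (0 < nth 0 xs 1) && (nth 0 xs 1 * i.+1 <= nth 0 xs 0))); comp.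
move=> xs _; move: (nth 0 xs 0) (nth 0 xs 1) => a [|b].
  by rewrite divn0 big1.
rewrite -[LHS](@sum_ltn a) ?leq_div //.
by apply: eq_bigr => i _; rewrite leq_divRL // mulnC.
Qed.
#[global] Hint Resolve computable_div : comp.

Lemma computable_mod k G H : computable k G -> computable k H ->
  computable k (fun xs => G xs %% H xs).
Proof.
move=> cG cH; apply: (computable_ext (F := fun xs =>
  G xs - G xs %/ H xs * H xs)); last by comp.
by move=> xs _; rewrite {2}(divn_eq (G xs) (H xs)) addKn.
Qed.
#[global] Hint Resolve computable_mod : comp.

Lemma decides_dvd k G H : computable k G -> computable k H ->
  decides k (fun xs => G xs %| H xs).
Proof. by move=> cG cH; rewrite /dvdn; comp. Qed.
#[global] Hint Resolve decides_dvd : comp.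

(** The recursion keeps the last common divisor met up to [H xs]. Positivity of [H xs] bounds the
    gcd by [H xs]; for [H xs = 0] the gcd would be [G xs], out of the range searched. *)
Lemma computable_gcd k G H : computable k G -> computable k H ->
  (forall xs, 0 < H xs) -> computable k (fun xs => gcdn (G xs) (H xs)).
Proof.
move=> cG cH H0; pose com a b d := (d %| a) && (d %| b).
apply: (computable_ext (F := fun xs => nat_rect (fun=> nat) 0 (fun m r =>
  if com (G xs) (H xs) m.+1 then m.+1 else r) (H xs))) => [xs _ /=|].
  move: (G xs) (H xs) (H0 xs) => a b b0.
  have [n [gn ngb]] : exists n, gcdn a b + n = b /\ (0 < gcdn a b).
    exists (b - gcdn a b); rewrite gcdn_gt0 b0 orbT subnKC //.
    by apply: dvdn_leq => //; rewrite dvdn_gcdr.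
  set F := nat_rect _ _ _; rewrite -{2}gn; elim: n {gn} => [|n IH].
    rewrite addn0; case E: (gcdn a b) ngb => [//|g] _ /=.
    by rewrite /com -E dvdn_gcdl dvdn_gcdr.
  rewrite addnS /= /com -dvdn_gcd gtnNdvd //; lia.
apply: (@computable_apply2 _ (fun a b => nat_rect (fun=> nat) 0 (fun m r =>
  if com a b m.+1 then m.+1 else r) b)) => //.
apply: (@computable_rec 2 (fun=> 0) (fun m r ys =>
  if com (nth 0 ys 0) (nth 0 ys 1) m.+1 then m.+1 else r)); rewrite /com; comp.
Qed.

(** * Step-bounded evaluation *)

(* [step n e xs] is [y.+1] if [e] is found to return [y] on [xs] when every
   unbounded search is cut off at [n], and [0] otherwise.  In the case of
   [RMin] the state of the search is [0] while it goes on, [1] once it has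
   failed, and [m.+2] once it has returned [m]. *)
Fixpoint step (n : nat) (e : recf) (xs : seq nat) {struct e} : nat :=
  match e with
  | RZero => 1
  | RSucc => if xs is x :: _ then x.+2 else 0
  | RProj i => if i < size xs then (nth 0 xs i).+1 else 0
  | RComp f gs =>
      let ys := [seq step n g xs | g <- gs] in
      if all (leq 1) ys then step n f (map predn ys) else 0
  | RPrec f g =>
      if xs is m :: zs then
        nat_rect (fun=> nat) (step n f zs) (fun m r =>
          if r == 0 then 0 else step n g [:: m, r.-1 & zs]) m
      else 0
  | RMin f =>
      (nat_rect (fun=> nat) 0 (fun m r =>
         if r == 0 then
           (if step n f (m :: xs) == 0 then 1
            else if step n f (m :: xs) == 1 then m.+2 else 0)
         else r) n).-1
  end.

Lemma step_sound n e xs y : step n e xs = y.+1 -> eval e xs y.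
Proof.
elim/recf_nested_ind: e xs y => [||i|f gs IHf IHgs|f g IHf IHg|f IHf] xs y /=.
- by case=> <-; exact: eZero.
- by case: xs => // x xs [<-]; exact: eSucc.
- by case: ifP => // ix [<-]; exact: eProj.
- case: ifP => // ps /IHf Hf; apply: eComp Hf.
  elim: gs IHgs ps => [_ _|g gs IH [Hg Hgs] /= /andP[pg pgs]].
    exact: esNil.
  apply: esCons; last exact: IH.
  by apply: Hg; rewrite prednK.
- case: xs => // m zs; elim: m y => [|m IHm] y /=.
    by move/IHf => ?; exact: ePrec0.
  case: (nat_rect _ _ _ _) IHm => //= r /(_ r erefl) Hr /IHg Hg.
  exact: ePrecS Hr Hg.
(* Invariant of the search after [N] rounds: state 0 certifies nonzero values at all arguments below
   [N], state [m.+2] certifies that [m] is the result. *)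
- have : forall N r, nat_rect (fun=> nat) 0 (fun m r =>
       if r == 0 then
         (if step n f (m :: xs) == 0 then 1
          else if step n f (m :: xs) == 1 then m.+2 else 0)
       else r) N = r ->
     (r = 0 -> forall m, m < N -> exists k, eval f (m :: xs) k.+1) /\
     (forall m, r = m.+2 -> eval (RMin f) xs m).
    elim=> [|N IHN] r /=; first by move=> <-; split.
    case: eqP => [r0|r0 rE]; last first.
      have [H1 H2] := IHN _ rE; split=> // r00; by rewrite r00 in rE.
    have [/(_ erefl) H1 _] := IHN _ r0.
    case: eqP => [_ <-|]; first by split.
    case E : (step n f (N :: xs)) => [//|u] _ /=.
    case: eqP => [[u0]|uN] <-; last first.
      split=> // _ m; rewrite ltnS leq_eqVlt => /orP[/eqP->|]; last exact: H1.
      by exists u.-1; apply: IHf; rewrite prednK //; case: u uN {E}.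
    by split=> // m [<-]; apply: eMin => //; apply: IHf; rewrite E u0.
  move=> /(_ n _ erefl)[_ H] E; apply: H.
  by move: E; case: (nat_rect _ _ _ _) => //= u ->.
Qed.

Definition ultimately (P : nat -> Prop) : Prop :=
  exists n0, forall n, n0 <= n -> P n.

Lemma ultimately_and P Q :
  ultimately P -> ultimately Q -> ultimately (fun n => P n /\ Q n).
Proof.
move=> [a Ha] [b Hb]; exists (maxn a b) => n; rewrite geq_max => /andP[an bn].
by split; [apply: Ha|apply: Hb].
Qed.

Lemma ultimately_impl (P Q : nat -> Prop) :
  (forall n, P n -> Q n) -> ultimately P -> ultimately Q.
Proof. by move=> PQ [a Ha]; exists a => n /Ha /PQ. Qed.

Lemma ultimately_below (P : nat -> nat -> Prop) N :
  (forall m, m < N -> ultimately (P m)) ->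
  ultimately (fun n => forall m, m < N -> P m n).
Proof.
elim: N => [|N IH] H; first by exists 0.
have HN := H N (ltnSn N).
have {}/IH HI : forall m, m < N -> ultimately (P m) by move=> m mN; apply/H/ltnW.
apply: ultimately_impl (ultimately_and HN HI) => n [PN Pm] m.
by rewrite ltnS leq_eqVlt => /orP[/eqP->|/Pm].
Qed.

Lemma step_complete e xs y :
  eval e xs y -> ultimately (fun n => step n e xs = y.+1).
Proof.
elim/recf_nested_ind: e xs y => [||i|f gs IHf IHgs|f g IHf IHg|f IHf] xs y ev.
- by inversion ev; subst; exists 0.
- by inversion ev; subst; exists 0.
- by inversion ev as [| |i0 xs0 Hi| | | |]; subst; exists 0 => n _ /=; rewrite Hi.
- inversion ev as [| | |f' gs' xs' ys y' Hgs Hf| | |]; subst.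
  have : ultimately (fun n => [seq step n g xs | g <- gs] = map succn ys).
    elim: gs ys {Hf ev} IHgs Hgs => [|g gs IH] ys Hall Hgs.
      by inversion Hgs; subst; exists 0.
    inversion Hgs as [|g' gs' xs' y1 ys' H1 H2]; subst.
    case: Hall => /(_ _ _ H1) E1 /IH/(_ H2) E2.
    by apply: ultimately_impl (ultimately_and E1 E2) => n /= [-> ->].
  move=> /ultimately_and /(_ (IHf _ _ Hf)); apply: ultimately_impl => n [E E'] /=.
  rewrite E all_map -map_comp (eq_map (g := id)) // map_id E'.
  by case: allP => // -[] x _.
- case: xs ev => [|m xs] ev; first by inversion ev.
  elim: m y ev => [|m IHm] y ev.
    inversion ev as [| | | |f' g' xs' y' Hf| |]; subst.
    by apply: ultimately_impl (IHf _ _ Hf) => n /=.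
  inversion ev as [| | | | |f' g' m' xs' r y' Hr Hg|]; subst.
  apply: ultimately_impl (ultimately_and (IHm _ Hr) (IHg _ _ Hg)) => n [E E'].
  by move: E => /= -> /=.
- inversion ev as [| | | | | |f' xs' m H0 Hm]; subst.
  (* Finitely many thresholds are merged. The bound is [1 <] because a value found nonzero appears
     in [step] shifted by one. A cut-off above [y] then reaches the zero at [y], after which the
     state stays frozen. *)
  have Hm' : ultimately (fun n => forall m, m < y -> 1 < step n f (m :: xs)).
    apply: ultimately_below => m /Hm [k /IHf]; apply: ultimately_impl => n ->.
    by [].
  have E0 := IHf _ _ H0.
  have Ey : ultimately (fun n => y < n) by exists y.+1.
  apply: ultimately_impl (ultimately_and Ey (ultimately_and E0 Hm')).
  move=> n [yn [E0' Em]] /=; set F := nat_rect _ _ _.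
  have FS m : F m.+1 = if F m == 0 then
      (if step n f (m :: xs) == 0 then 1
       else if step n f (m :: xs) == 1 then m.+2 else 0) else F m by [].
  have F0 : forall m, m <= y -> F m = 0.
    elim=> [//|m IHm] my /=; rewrite IHm 1?ltnW //=.
    by have := Em _ my; case: (step _ _ _) => [|[]].
  have Fy : forall d, F (y + d).+1 = y.+2.
    elim=> [|d IHd]; first by rewrite addn0 /= F0 //= E0'.
    by rewrite addnS FS IHd.
  by have -> : n = (y + (n - y.+1)).+1 by [lia]; rewrite Fy.
Qed.

(** Determinism comes from [step] being a function: for large [n] both results are read off the same
    value. *)
Lemma eval_fun e xs y z : eval e xs y -> eval e xs z -> y = z.
Proof.
move=> /step_complete Hy /step_complete Hz.
have [n /(_ n (leqnn n)) [-> []//]] := ultimately_and Hy Hz.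
Qed.

Lemma All_vars k a d : a + d <= k ->
  All (computable k) [seq (fun xs => nth 0 xs i) | i <- iota a d].
Proof.
move=> adk; apply/All_map/All_seq => i; rewrite mem_iota => ik.
by apply: computable_var; lia.
Qed.

Lemma vars_behead a xs :
  [seq G xs | G <- [seq (fun xs => nth 0 xs i) | i <- iota a (size xs - a)]] =
  drop a xs.
Proof.
rewrite -map_comp /comp -[RHS](mkseq_nth 0) /mkseq size_drop -{1}[a]addn0 iotaDl.
by rewrite -map_comp; apply: eq_map => i /=; rewrite nth_drop.
Qed.

(** Induction on the fixed code [e]; the arity [k] stays general because [RComp], [RPrec] and [RMin]
    call their subcodes with other arities. *)
Lemma computable_step e k :
  computable k.+1 (fun ys => step (nth 0 ys 0) e (behead ys)).
Proof.
elim/recf_nested_ind: e k => [||i|f gs IHf IHgs|f g IHf IHg|f IHf] k /=.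
- by comp.
- case: k => [|k]; first by apply: computable_ext (computable_const _ 0) => -[|? []].
  apply: (computable_ext (F := fun xs => (nth 0 xs 1).+2)); last by comp.
  by move=> [|a [|b xs]].
- have [ik|ki] := ltnP i k.
    apply: (computable_ext (F := fun xs => (nth 0 xs i.+1).+1)).
      by move=> [|a xs] //= [->]; rewrite ik.
    by apply/computable_succ/computable_var.
  apply: computable_ext (computable_const _ 0) => -[|a xs] //= [->].
  by rewrite ltnNge ki.
- apply: computable_if; last exact: computable_const.
    elim: gs IHgs => [_|g gs IH [/(_ k) cg /IH IHgs]] /=.
      exact: computable_const.
    by apply: decides_and => //; comp.
  have := @computable_subst k.+1
    (fun ys => step (nth 0 ys 0) f (behead ys))
    ((fun ys => nth 0 ys 0) ::
     [seq (fun ys => (step (nth 0 ys 0) g (behead ys)).-1) | g <- gs]).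
  rewrite /= size_map => /(_ (IHf _)) cR.
  apply: computable_ext (cR _) => /= [xs sz|]; first by rewrite -!map_comp.
  split; first by comp.
  apply/All_map; apply: All_impl IHgs => g /(_ k); exact: computable_pred.
- case: k => [|k]; first by apply: computable_ext (computable_const _ 0) => -[|? []].
  apply: (computable_ext (F := fun xs => nat_rect (fun=> nat)
    (step (nth 0 xs 0) f (behead (behead xs))) (fun m r =>
          if r == 0 then 0 else step (nth 0 xs 0) g [:: m, r.-1 & behead (behead xs)])
    (nth 0 xs 1))).
    by move=> [|a [|b xs]].
  apply: (@computable_rec k.+2 (fun xs => step (nth 0 xs 0) f (behead (behead xs)))
   (fun m r xs => if r == 0 then 0
     else step (nth 0 xs 0) g [:: m, r.-1 & behead (behead xs)])); last by comp.
    have := @computable_subst k.+2 (fun ys => step (nth 0 ys 0) f (behead ys))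
      ((fun xs => nth 0 xs 0) :: [seq (fun xs => nth 0 xs i) | i <- iota 2 k]).
    rewrite /= size_map size_iota => /(_ (IHf _)) cR.
    apply: computable_ext (cR _) => [[|a [|b xs]] //= [sz]|].
      have := vars_behead 2 [:: a, b & xs]; rewrite /= sz.
      by rewrite !subSS subn0 => ->; rewrite drop0.
    by split; [comp|exact: All_vars].
  apply: computable_if; [by comp|by comp|].
  have := @computable_subst k.+4 (fun ys => step (nth 0 ys 0) g (behead ys))
      [:: (fun xs => nth 0 xs 2), (fun xs => nth 0 xs 0), (fun xs => (nth 0 xs 1).-1)
     & [seq (fun xs => nth 0 xs i) | i <- iota 4 k]].
  rewrite /= size_map size_iota => /(_ (IHg _)) cR.
  apply: computable_ext (cR _) => [[|a [|b [|c [|d xs]]]] //= [sz]|].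
    have := vars_behead 4 [:: a, b, c, d & xs]; rewrite /= sz.
    by rewrite !subSS subn0 => ->; rewrite drop0.
  by split; [comp|split; [comp|split; [comp|exact: All_vars]]].
- apply: computable_pred.
  apply: (@computable_rec k.+1 (fun=> 0) (fun m r xs =>
     if r == 0 then
         (if step (nth 0 xs 0) f (m :: behead xs) == 0 then 1
          else if step (nth 0 xs 0) f (m :: behead xs) == 1 then m.+2 else 0)
       else r)); try by comp.
  have cs : computable k.+3 (fun ys =>
     step (nth 0 (behead (behead ys)) 0) f (nth 0 ys 0 :: behead (behead (behead ys)))).
    have := @computable_subst k.+3 (fun ys => step (nth 0 ys 0) f (behead ys))
      [:: (fun xs => nth 0 xs 2), (fun xs => nth 0 xs 0)
     & [seq (fun xs => nth 0 xs i) | i <- iota 3 k]].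
    rewrite /= size_map size_iota => /(_ (IHf _)) cR.
    apply: computable_ext (cR _) => [[|a [|b [|c xs]]] //= [sz]|].
      have := vars_behead 3 [:: a, b, c & xs]; rewrite /= sz.
      by rewrite !subSS subn0 => ->; rewrite drop0.
    by split; [comp|split; [comp|exact: All_vars]].
  by comp.
Qed.

(** An equivalence, because [partial_recursive] also demands divergence outside the domain. *)
Lemma computable_minimize D : computable 2 (fun xs => D (nth 0 xs 0) (nth 0 xs 1)) ->
  exists e, forall x y, eval e [:: x] y <->
    D y x = 0 /\ forall m, m < y -> D m x != 0.
Proof.
move=> [e He]; exists (RMin e) => x y; split=> [ev|[D0 Dm]].
  inversion ev as [| | | | | |f' xs' m H0 Hm]; subst; split.
    by apply: (eval_fun (He [:: y; x] erefl) H0).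
  by move=> m /Hm [k /(eval_fun (He [:: m; x] erefl)) /= ->].
apply: eMin; first by rewrite -D0; exact: (He [:: y; x]).
move=> m /Dm; have := He [:: m; x] erefl => /=.
by case: (D m x) => // k Hk _; exists k.
Qed.

(** * Codes of sequences and of binary strings *)

(** [CodeSeq.code (n :: s)] is [2 ^ n] times the odd number [2 * code s + 1], so the head is the
    2-adic valuation and the tail is half of the odd part, rounded down. *)
Definition chead (t : nat) : nat := \sum_(i < t) (2 ^ i.+1 %| t).
Definition ctail (t : nat) : nat := t %/ 2 ^ chead t %/ 2.

Lemma chead_code n s : chead (CodeSeq.code (n :: s)) = n.
Proof.
rewrite /chead /=; set t := _ * _; rewrite -[RHS](@sum_ltn t); last first.
  by rewrite (leq_trans (ltnW (ltn_expl n (isT : 1 < 2)))) // leq_pmulr.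
apply: eq_bigr => i _; congr nat_of_bool; rewrite /t.
have [i_n|n_i] := ltnP i n; first by rewrite dvdn_mulr // dvdn_exp2l.
apply/negP => /(dvdn_trans (dvdn_exp2l 2 (n_i : n.+1 <= i.+1))).
by rewrite expnSr dvdn_pmul2l ?expn_gt0 // dvdn2 /= odd_double.
Qed.

Lemma ctail_code n s : ctail (CodeSeq.code (n :: s)) = CodeSeq.code s.
Proof.
rewrite /ctail chead_code /= mulKn ?expn_gt0 //.
by rewrite divn2 /= uphalf_double.
Qed.

Lemma iter_ctail_code i s :
  iter i ctail (CodeSeq.code s) = CodeSeq.code (drop i s).
Proof.
elim: i s => [|i IH] s; first by rewrite drop0.
rewrite iterSr; case: s => [|n s]; last by rewrite ctail_code IH.
by rewrite /ctail /= !div0n -[0]/(CodeSeq.code [::]) IH drop_oversize.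
Qed.

Lemma chead_iter_code i s :
  i < size s -> chead (iter i ctail (CodeSeq.code s)) = nth 0 s i.
Proof. by move=> ?; rewrite iter_ctail_code (drop_nth 0) // chead_code. Qed.

Lemma chead_le t : chead t <= t.
Proof.
rewrite /chead -[leqRHS]card_ord -sum1_card; apply: leq_sum => i _.
by case: (_ %| _).
Qed.

Lemma ctail_le t : ctail t <= t.
Proof. by rewrite /ctail (leq_trans (leq_div _ _)) ?leq_div. Qed.

Lemma computable_chead k G :
  computable k G -> computable k (fun xs => chead (G xs)).
Proof.
apply: (@computable_apply1 k chead); rewrite /chead.
by apply: (@computable_sum 1 (fun i xs => 2 ^ i.+1 %| nth 0 xs 0)); comp.
Qed.
#[global] Hint Resolve computable_chead : comp.

Lemma computable_ctail k G :
  computable k G -> computable k (fun xs => ctail (G xs)).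
Proof. by move=> cG; rewrite /ctail; comp. Qed.
#[global] Hint Resolve computable_ctail : comp.

Lemma computable_iter_ctail k i G :
  computable k G -> computable k (fun xs => iter i ctail (G xs)).
Proof. by move=> cG; elim: i => //= i IH; comp. Qed.
#[global] Hint Resolve computable_iter_ctail : comp.

Lemma computable_code k Gs :
  All (computable k) Gs ->
  computable k (fun xs => CodeSeq.code [seq G xs | G <- Gs]).
Proof.
elim: Gs => [_|G Gs IH [cG /IH cGs]] /=; first by comp.
apply: computable_mul; first by comp.
apply: computable_succ; apply: computable_ext (computable_add cGs cGs) => xs _.
by rewrite addnn.
Qed.

(* Binary expansion on [l] digits, most significant first. *)
Fixpoint bits (j l : nat) : bstring :=
  if l is l'.+1 then odd (j %/ 2 ^ l') :: bits j l' else [::].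

Fixpoint bval (p : bstring) : nat :=
  if p is b :: p' then b * 2 ^ size p' + bval p' else 0.

Lemma size_bits j l : size (bits j l) = l.
Proof. by elim: l => //= l ->. Qed.

Lemma bval_lt p : bval p < 2 ^ size p.
Proof.
elim: p => //= b p IH; rewrite expnS mul2n -addnn.
by case: b; rewrite ?mul1n ?mul0n ?ltn_add2l // ltn_addl.
Qed.

Lemma bval_cat p q : bval (p ++ q) = bval p * 2 ^ size q + bval q.
Proof.
by elim: p => //= b p ->; rewrite size_cat expnD mulnDl addnA mulnA.
Qed.

Lemma bits_mod j l : bits (j %% 2 ^ l) l = bits j l.
Proof.
suff H l' : l' <= l -> bits (j %% 2 ^ l) l' = bits j l' by apply: H.
elim: l' => //= l' IH l'l; rewrite IH 1?ltnW //; congr (_ :: _).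
rewrite [in RHS](divn_eq j (2 ^ l)); set r := j %% _; set q := j %/ _.
have -> : 2 ^ l = 2 ^ (l - l'.+1) * 2 * 2 ^ l'.
  by rewrite -mulnA -expnS -expnD subnK.
by rewrite mulnA divnMDl ?expn_gt0 // oddD !oddM !andbF.
Qed.

Lemma bval_bits j l : bval (bits j l) = j %% 2 ^ l.
Proof.
elim: l => [|l IH] /=; first by rewrite modn1.
rewrite IH size_bits -modn2; set d := j %/ 2 ^ l; set r := j %% 2 ^ l.
have -> : j = d %/ 2 * 2 ^ l.+1 + (d %% 2 * 2 ^ l + r).
  by rewrite expnS mulnA addnA -mulnDl -divn_eq -divn_eq.
rewrite modnMDl [RHS]modn_small // expnS.
have : r < 2 ^ l by rewrite ltn_pmod // expn_gt0.
have := ltn_pmod d (isT : 0 < 2); case: (_ %% 2) => [|[]] // _; lia.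
Qed.

Lemma bits_bval p : bits (bval p) (size p) = p.
Proof.
elim: p => //= b p IH; congr (_ :: _).
  rewrite divnMDl ?expn_gt0 // divn_small ?bval_lt // addn0.
  by case: b.
by rewrite -[RHS]IH -bits_mod modnMDl bits_mod.
Qed.

Lemma pickle_bstring (s : bstring) : pickle s = CodeSeq.code (map nat_of_bool s).
Proof. by []. Qed.

Lemma computable_pickle_bits k G H : computable k G -> computable k H ->
  computable k (fun xs => pickle (bits (G xs) (H xs))).
Proof.
apply: (@computable_apply2 k (fun j l => pickle (bits j l))).
apply: (computable_ext (F := fun xs => nat_rect (fun=> nat) 0
  (fun i r => 2 ^ ((nth 0 xs 0 %/ 2 ^ i) %% 2) * (r + r).+1) (nth 0 xs 1))).
  move=> xs _; rewrite pickle_bstring; elim: (nth 0 xs 1) => //= l <-.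
  by rewrite addnn modn2.
apply: (@computable_rec 2 (fun=> 0)
  (fun i r xs => 2 ^ ((nth 0 xs 0 %/ 2 ^ i) %% 2) * (r + r).+1)); comp.
Qed.
#[global] Hint Resolve computable_pickle_bits : comp.

(** * The coding theorem *)

Local Open Scope ring_scope.

Lemma ler_sum_subset (K : numDomainType) (T : eqType) (s t : seq T) (F : T -> K) :
  uniq s -> uniq t -> {subset s <= t} -> (forall x, 0 <= F x) ->
  \sum_(x <- s) F x <= \sum_(x <- t) F x.
Proof.
move=> us ut st F0; have ps : perm_eq s [seq x <- t | x \in s].
  apply: uniq_perm; rewrite ?filter_uniq // => x.
  by rewrite mem_filter andb_idr // => /st.
rewrite (perm_big _ ps) big_filter [leRHS](bigID (mem s)) /= lerDl.
by rewrite sumr_ge0.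
Qed.

Lemma pow2V_halve (K : numFieldType) n :
  (2 : K) ^- n = 2 ^- n.+1 + 2 ^- n.+1.
Proof. by rewrite exprS invfM -mulrDl -[2^-1]div1r -splitr mul1r. Qed.

Lemma sum_pow2_below (K : realFieldType) (m : K) B : 0 <= m ->
  \sum_(k < B | 2 ^- k < m) (2 : K) ^- k.+1 <= m.
Proof.
(* Strengthened for the induction: each admissible term [2 ^- B.+1] is exactly the drop from
   [2 ^- B] to [2 ^- B.+1], and while no term is admissible the maximum is 0. *)
move=> m0; suff : \sum_(k < B | 2 ^- k < m) (2 : K) ^- k.+1 <=
    Num.max 0 (m - 2 ^- B).
  by move=> /le_trans; apply; rewrite ge_max m0 gerBl invr_ge0 exprn_ge0.
elim: B => [|B IH]; first by rewrite big_ord0 le_max lexx.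
have E := pow2V_halve K B.
have P : 0 < (2 : K) ^- B.+1 by rewrite invr_gt0 exprn_gt0.
rewrite big_mkcond big_ord_recr /= -big_mkcond /=.
case: ifPn => [Bm|]; last rewrite -leNgt => mB.
  apply: le_trans (lerD IH (lexx _)) _.
  rewrite (max_idPr _); last by rewrite subr_ge0 ltW.
  by rewrite le_max E opprD addrA subrK lexx orbT.
rewrite addr0; apply: le_trans IH _; rewrite (max_idPl _) ?subr_le0 //.
by rewrite le_max lexx.
Qed.

(** * Kraft-Chaitin machine serving an enumeration of requests *)

Section KraftChaitin.

Variable cond : nat -> bstring -> nat -> bool.

(* A stage [t] codes the request for a word of length [reqk t + 2] describing
   [reqs t], raised if [cond] holds at time [reqn t]. *)
Definition reqn (t : nat) : nat := chead t.
Definition reqs (t : nat) : bstring :=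
  bits (chead (ctail t)) (chead (ctail (ctail t))).
Definition reqk (t : nat) : nat := chead (ctail (ctail (ctail t))).

Lemma reqP n s k : exists t, [/\ reqn t = n, reqs t = s & reqk t = k].
Proof.
exists (CodeSeq.code [:: n; bval s; size s; k]).
by rewrite /reqn /reqs /reqk !(ctail_code, chead_code) bits_bval.
Qed.

(** Keeps the exponent [t - reqk i] in [used] a genuine subtraction, and confines the lengths
    requested before stage [t] to a finite range. *)
Lemma reqk_le t : (reqk t <= t)%N.
Proof.
rewrite /reqk; apply: leq_trans (chead_le _) _.
by do !apply: leq_trans (ctail_le _) _.
Qed.

Definition raised (t : nat) : bool := cond (reqn t) (reqs t) (reqk t).

(** The same pair of string and length may be raised at many times [n]; only its first stage is
    served, so that its weight is counted once. Strings are compared through their codes to make the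
    test visibly decidable. *)
Definition active (t : nat) : bool :=
  raised t && [forall i : 'I_t,
    ~~ (raised i && (pickle (reqs i) == pickle (reqs t)) && (reqk i == reqk t))].

(* [2 ^- t.+1] times [used t] is the total length of the intervals allotted
   before stage [t]; the word [word t] is the leftmost dyadic interval of
   length [2 ^- (reqk t).+2] in the next interval of twice that length. *)
Definition used (t : nat) : nat := (\sum_(i < t) active i * 2 ^ (t - reqk i))%N.
Definition slot (t : nat) : nat :=
  ((used t * 2 ^ (reqk t).+2 + (2 ^ t.+1).-1) %/ 2 ^ t.+1)%N.
Definition word (t : nat) : bstring := bits (slot t) (reqk t).+2.

(** The least stage is the one that the mu-operator finds; once the words are known to be
    prefix-free it is the only one. *)
Definition kc_machine (p : bstring) : option bstring :=
  match pselect (exists t, active t && (word t == p)) with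
  | left h => Some (reqs (ex_minn h))
  | right _ => None
  end.

(** * Recursiveness of the machine *)

Section Recursive.

Hypothesis cond_rec : exists e, forall n s k,
  eval e [:: n; pickle s; k] (cond n s k).

Lemma computable_reqs k G :
  computable k G -> computable k (fun xs => pickle (reqs (G xs))).
Proof. by move=> cG; rewrite /reqs; comp. Qed.
Hint Resolve computable_reqs : comp.

Lemma computable_reqk k G :
  computable k G -> computable k (fun xs => reqk (G xs)).
Proof. by move=> cG; rewrite /reqk; comp. Qed.
Hint Resolve computable_reqk : comp.

Lemma decides_raised k G : computable k G -> decides k (fun xs => raised (G xs)).
Proof.
move=> cG; have [e He] := cond_rec.
apply: (@computable_run k e [:: (fun xs => reqn (G xs));
  (fun xs => pickle (reqs (G xs))); (fun xs => reqk (G xs))]).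
  by split; [rewrite /reqn; comp|split; [comp|split; [comp|]]].
by move=> xs _; exact: He.
Qed.
Hint Resolve decides_raised : comp.

Lemma decides_active k G : computable k G -> decides k (fun xs => active (G xs)).
Proof.
apply: (@computable_apply1 k (fun t => nat_of_bool (active t))).
rewrite -/(decides 1 (fun xs => active (nth 0%N xs 0))) /active.
apply: decides_and; first by comp.
apply: (@decides_all_below 1 (fun i xs => ~~ (raised i &&
  (pickle (reqs i) == pickle (reqs (nth 0%N xs 0))) &&
  (reqk i == reqk (nth 0%N xs 0))))); comp.
Qed.
Hint Resolve decides_active : comp.

Lemma computable_word k G :
  computable k G -> computable k (fun xs => pickle (word (G xs))).
Proof.
apply: (@computable_apply1 k (fun t => pickle (word t))).
have cu : computable 1 (fun xs => used (nth 0%N xs 0)).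
  by apply: (@computable_sum 1 (fun i xs =>
    active i * 2 ^ (nth 0 xs 0 - reqk i))%N); comp.
by rewrite /word /slot; comp.
Qed.
Hint Resolve computable_word : comp.

Lemma kc_machine_recursive : partial_recursive kc_machine.
Proof.
(* The test is negated since the mu-operator looks for a zero; [f] then recovers the described
   string from the stage found. *)
have [e He] : exists e, forall x y, eval e [:: x] y <->
    (~~ (active y && (pickle (word y) == x)) : nat) = 0%N /\
    forall m, (m < y)%N -> (~~ (active m && (pickle (word m) == x)) : nat) != 0%N.
  apply: (@computable_minimize
    (fun t x => ~~ (active t && (pickle (word t) == x)) : nat)); comp.
have [f Hf] : computable 1 (fun xs => pickle (reqs (nth 0%N xs 0))) by comp.
exists (RComp f [:: e]) => s y; split=> [ev|[t []]].
  inversion ev as [| | |f' gs' xs' ys y' Hes Hy| | |]; subst.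
  inversion Hes as [|g gs xs t ts Ht Hts]; subst; inversion Hts; subst.
  move: Ht => /He[]; rewrite (inj_eq (pcan_inj pickleK)) => At Am.
  have yE := eval_fun Hy (Hf [:: t] erefl).
  rewrite /kc_machine; case: pselect => [h|[]]; last first.
    by exists t; move: At; case: (_ && _).
  exists (reqs (ex_minn h)); split => //; rewrite yE; congr (pickle (reqs _)).
  case: ex_minnP => i Ai /(_ t) ti; apply/eqP; rewrite /= eqn_leq ti; last first.
    by move: At; case: (_ && _).
  rewrite andbT leqNgt; apply/negP => /Am.
  by rewrite (inj_eq (pcan_inj pickleK)) Ai.
rewrite /kc_machine; case: pselect => // h [<-] ->.
case: ex_minnP => i Ai imin; apply: (@eComp _ _ _ [:: i]).
  apply: esCons; last exact: esNil.
  apply/He; rewrite (inj_eq (pcan_inj pickleK)) Ai; split=> // m mi.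
  rewrite (inj_eq (pcan_inj pickleK)) eqb0 negbK; apply/negP => /imin.
  by rewrite leqNgt mi.
exact: (Hf [:: i]).
Qed.

End Recursive.

(** * Placement of the requests in the unit interval *)

Section Allocation.

Variables (R : realType) (m : bstring -> R).
Hypothesis m_ge0 : forall s, 0 <= m s.
Hypothesis m_sum : forall S, uniq S -> \sum_(s <- S) m s <= 1.
Hypothesis cond_m : forall n s k, cond n s k -> 2 ^- k < m s.

(** The real number encoded by [used t]: an active stage [t] owns the interval from [left_end t] to
    [left_end t.+1]. *)
Let left_end (t : nat) : R := \sum_(i < t | active i) 2 ^- (reqk i).+1.

Lemma active_inj i j : active i -> active j ->
  reqs i = reqs j -> reqk i = reqk j -> i = j.
Proof.
wlog ij : i j / (i < j)%N => [H Ai Aj es ek|Ai /andP[_ /forallP/(_ (Ordinal ij))]].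
  by case: (ltngtP i j) => // ij; [|apply/esym]; apply: H.
by move=> /= H es ek; move: H; rewrite es ek !eqxx !andbT; case/andP: Ai => ->.
Qed.

(** The served pairs are distinct and satisfy [2 ^- k < m s]. By [sum_pow2_below] those of one
    string weigh at most [m s], and the values of [m] sum to at most 1. *)
Lemma left_end_le1 t : left_end t <= 1.
Proof.
pose Q := [seq (reqs i, reqk i) | i <- iota 0 t & active i].
pose S := undup [seq reqs i | i <- iota 0 t].
pose F (q : bstring * nat) : R := 2 ^- q.2.+1.
have -> : left_end t = \sum_(q <- Q) F q.
  by rewrite big_map big_filter /left_end -(big_mkord active (fun i => 2 ^- (reqk i).+1)) /index_iota subn0.
have uQ : uniq Q.
  rewrite map_inj_in_uniq ?filter_uniq ?iota_uniq // => i j.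
  rewrite !mem_filter => /andP[Ai _] /andP[Aj _] [es ek].
  exact: active_inj.
pose T := [seq q <- [seq (s, k) | s <- S, k <- iota 0 t] | 2 ^- q.2 < m q.1].
have uT : uniq T.
  apply/filter_uniq/allpairs_uniq; rewrite ?undup_uniq ?iota_uniq //.
  by move=> [a b] [c d].
have QT : {subset Q <= T}.
  apply/allP; rewrite all_map; apply/allP => i.
  rewrite mem_filter mem_iota add0n => /andP[Ai it]; rewrite /= mem_filter /=; apply/andP; split.
    by case/andP: Ai => /cond_m.
  apply/allpairsP; exists (reqs i, reqk i); split=> //=.
    by rewrite mem_undup map_f // mem_iota.
  by rewrite mem_iota add0n (leq_ltn_trans (reqk_le i)).
apply: le_trans (ler_sum_subset uQ uT QT _) _ => [q|].
  by rewrite invr_ge0 exprn_ge0.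
rewrite big_filter big_mkcond big_allpairs; apply: le_trans (m_sum (undup_uniq _)).
apply: ler_sum => s _; apply: le_trans (sum_pow2_below t (m_ge0 s)).
rewrite -(big_mkord (fun k => 2 ^- k < m s) (fun k => 2 ^- k.+1)).
by rewrite /index_iota subn0 [leRHS]big_mkcond.
Qed.

Lemma left_endS t : active t -> left_end t.+1 = left_end t + 2 ^- (reqk t).+1.
Proof. by move=> At; rewrite /left_end big_mkcond big_ord_recr /= At -big_mkcond. Qed.

Lemma left_end_homo t u : (t <= u)%N -> left_end t <= left_end u.
Proof.
move=> /subnKC <-; elim: (u - t)%N => [|d IH]; first by rewrite addn0.
apply: le_trans IH _; rewrite addnS /left_end [leRHS]big_mkcond big_ord_recr /=.
rewrite -big_mkcond /= lerDl; case: ifP => // _.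
Qed.

Lemma left_endE t : left_end t = (used t)%:R / 2 ^+ t.+1.
Proof.
rewrite /left_end /used natr_sum mulr_suml big_mkcond; apply: eq_bigr => i _.
case: ifP => _; rewrite ?mul0n ?mul0r // mul1n natrX.
have ki : (reqk i <= t)%N := leq_trans (reqk_le i) (ltnW (ltn_ord i)).
rewrite -[t.+1](@subnK (reqk i).+1) ?ltnS // subSS exprD invfM mulrA divff ?mul1r //.
Qed.

(** Left end of the dyadic interval of the reals whose binary expansion begins with [p]. *)
Let lo (p : bstring) : R := (bval p)%:R / 2 ^+ size p.

Lemma lo_prefix p q : prefix p q -> lo p <= lo q < lo p + 2 ^- size p.
Proof.
move=> /prefixP[r ->]; rewrite /lo bval_cat size_cat natrD natrM natrX exprD.
have P (n : nat) : 0 < (2 : R) ^+ n by rewrite exprn_gt0.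
have -> : ((bval p)%:R * 2 ^+ size r + (bval r)%:R) / (2 ^+ size p * 2 ^+ size r)
   = (bval p)%:R / 2 ^+ size p + ((bval r)%:R / 2 ^+ size r) * 2 ^- size p :> R.
  by field; rewrite !expf_neq0 // pnatr_eq0.
rewrite lerDl ltrD2l mulr_ge0 ?divr_ge0 ?invr_ge0 ?exprn_ge0 //=.
rewrite -[ltRHS]mul1r ltr_pM2r ?invr_gt0 // ltr_pdivrMr // mul1r -natrX ltr_nat.
exact: bval_lt.
Qed.

(** Rounding the left end up to a multiple of [2 ^- M] costs less than [2 ^- M], and the allotted
    interval has length [2 * 2 ^- M], so a dyadic interval of length [2 ^- M] still fits. *)
Lemma word_interval t : active t ->
  left_end t <= lo (word t) /\ lo (word t) + 2 ^- size (word t) <= left_end t.+1.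
Proof.
move=> At; have L1 := left_end_le1 t.+1; rewrite left_endS // in L1 *.
rewrite left_endE in L1 *; rewrite /lo /word bval_bits size_bits.
set a := used t in L1 *; set M := (reqk t).+2; set D := (2 ^ t.+1)%N.
have D0 : (0 < D)%N by rewrite expn_gt0.
(* [slot t] is the ceiling of [a * 2 ^ M / D]; [j1] and [j2] are its two defining inequalities. *)
have j1 : (a * 2 ^ M <= slot t * D)%N.
  rewrite /slot -/D -/M -/a.
  have := ltn_pmod (a * 2 ^ M + D.-1) D0.
  have := divn_eq (a * 2 ^ M + D.-1) D; lia.
have j2 : (slot t * D < a * 2 ^ M + D)%N.
  rewrite /slot -/D -/M -/a.
  have := divn_eq (a * 2 ^ M + D.-1) D; lia.
have M0 : 0 < (2 : R) ^+ M by rewrite exprn_gt0.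
have DR : (2 : R) ^+ t.+1 = D%:R by rewrite natrX.
have D0R : 0 < (D%:R : R) by rewrite ltr0n.
have k1 : (a%:R : R) / D%:R <= (slot t)%:R / 2 ^+ M.
  by rewrite ler_pdivrMr // mulrAC ler_pdivlMr // -natrX -!natrM ler_nat.
have k2 : (slot t)%:R / 2 ^+ M < (a%:R : R) / D%:R + 2 ^- M.
  rewrite ltr_pdivrMr // mulrDl mulVf ?gt_eqF // mulrAC.
  rewrite -(@ltr_pM2r _ D%:R) // mulrDl mul1r divfK ?gt_eqF //.
  by rewrite -natrX -!natrM -natrD ltr_nat.
rewrite DR pow2V_halve -/M in L1 *.
(* The total weight being at most 1 keeps [slot t] within [M] bits, so [bits] does not truncate
   it. *)
have k3 : (slot t < 2 ^ M)%N.
  rewrite -(ltr_nat R) natrX -[ltRHS]mul1r -ltr_pdivrMr //; apply: lt_le_trans L1.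
  by apply: lt_le_trans k2 _; rewrite lerD2l lerDl ltW // invr_gt0.
by rewrite modn_small //; split=> //; rewrite addrA lerD2r ltW.
Qed.

(** By [lo_prefix] the left end of the longer word lies in the dyadic interval of the shorter one,
    whereas different stages own disjoint intervals. *)
Lemma word_prefix t u : active t -> active u -> prefix (word t) (word u) -> t = u.
Proof.
move=> At Au /lo_prefix/andP[p1 p2]; have [a1 a2] := word_interval At.
have [b1 b2] := word_interval Au.
case: (ltngtP t u) => // /left_end_homo H.
  by have := lt_le_trans p2 (le_trans a2 (le_trans H b1)); rewrite ltxx.
have := le_trans b2 (le_trans H (le_trans a1 p1)).
by rewrite gerDl leNgt invr_gt0 exprn_gt0.
Qed.

Lemma kc_machine_prefix_free : prefix_free_dom kc_machine.
Proof.
move=> p q; rewrite /kc_machine.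
case: pselect => // h _; case: h => t /andP[At /eqP <-].
case: pselect => // h _; case: h => u /andP[Au /eqP <-] tu.
by rewrite (word_prefix At Au tu).
Qed.

Lemma kc_machine_covers n s k : cond n s k ->
  exists2 p, kc_machine p = Some s & size p = k.+2.
Proof.
move=> c; pose good t := [&& raised t, reqs t == s & reqk t == k].
have [t [tn ts tk]] := reqP n s k.
have ex : exists t, good t by exists t; rewrite /good /raised tn ts tk c !eqxx.
(* The stage given by [reqP] may repeat an earlier one; the least stage raising the same pair is
   active. *)
case: (ex_minnP ex) => {tn ts tk}t /and3P[rt /eqP ts /eqP tk] tmin.
have At : active t.
  rewrite /active rt; apply/forallP => i; apply/negP => /andP[/andP[ri]].
  rewrite (inj_eq (pcan_inj pickleK)) ts tk => es ek.
  by have := tmin i; rewrite /good ri es ek leqNgt ltn_ord => /(_ isT).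
exists (word t); last by rewrite size_bits tk.
rewrite /kc_machine; case: pselect => [h|[]]; last by exists t; rewrite At eqxx.
case: ex_minnP => u /andP[Au /eqP wu] _; congr Some.
by rewrite (word_prefix Au At) // wu prefix_refl.
Qed.

End Allocation.

End KraftChaitin.

(** [cond] enumerates the true inequalities [2 ^- k < m s]. The resulting machine describes [s] by
    words of length [k.+2], and [U] simulates it at the further cost [sim]. *)
Lemma coding_theorem (R : realType) (U : bstring -> option bstring)
    (m : bstring -> R) (cond : nat -> bstring -> nat -> bool) :
  optimal U -> (forall s, 0 <= m s) ->
  (forall S, uniq S -> \sum_(s <- S) m s <= 1) ->
  (exists e, forall n s k, eval e [:: n; pickle s; k] (cond n s k)) ->
  (forall s k, 2 ^- k < m s <-> exists n, cond n s k) ->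
  exists c : nat, forall s k, 2 ^- k < m s ->
    exists p, U p = Some s /\ (size p <= k + c)%N.
Proof.
move=> [_ hU] m0 ms cr cm.
have cm' n s k : cond n s k -> 2 ^- k < m s by move=> c; apply/cm; exists n.
have [sim Hsim] := hU (kc_machine cond) (conj (kc_machine_recursive cr)
  (kc_machine_prefix_free m0 ms cm')).
exists sim.+2 => s k /cm[n /(kc_machine_covers m0 ms cm')[p /Hsim[p' [Up' sp']] sp]].
by exists p'; split=> //; rewrite (leq_trans sp') // sp addSnnS addSnnS.
Qed.

(** * Codes of Gaussian rational matrices *)

Lemma pickle_gaussQ N (A : gaussQ N) :
  pickle A = CodeSeq.code [:: pickle A.1; pickle A.2].
Proof. by []. Qed.

(** Pickling goes through the graph of the entry function, where each value is tagged with its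
    index; hence the final [chead (ctail _)] in [cell_code]. *)
Lemma pickle_mx N (A : 'M[rat]_N) :
  pickle A = CodeSeq.code [seq CodeSeq.code [:: pickle ij; pickle (A ij.1 ij.2)]
                          | ij <- enum {: 'I_N * 'I_N}].
Proof.
transitivity (pickle (tval (tfgraph (mx_val A)))); first by [].
transitivity (CodeSeq.code (map pickle (tval (tfgraph (mx_val A))))); first by [].
rewrite -codom_tffun /codom /image_mem -map_comp; congr CodeSeq.code.
apply: eq_map => -[i j] /=; rewrite /fun_of_matrix; by [].
Qed.

Lemma pickle_rat (q : rat) :
  pickle q = CodeSeq.code [:: pickle (numq q); pickle (denq q)].
Proof. by case: q => -[]. Qed.

Lemma pickle_Posz (n : nat) :
  pickle (Posz n) = CodeSeq.code [:: CodeSeq.code [:: n]; 0%N].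
Proof. by []. Qed.

Lemma pickle_Negz (n : nat) :
  pickle (Negz n) = CodeSeq.code [:: 0%N; CodeSeq.code [:: n]].
Proof. by []. Qed.

Lemma chead0 : chead 0 = 0%N.
Proof. by rewrite /chead big_ord0. Qed.

(** An integer is coded by two slots, the first being empty for a negative one; [chead 0 = 0] then
    supplies the value 0. *)
Definition pos_part (x : nat) : nat := chead (chead x).

Lemma pos_partE (z : int) :
  pos_part (pickle z) = if z is Posz n then n else 0%N.
Proof.
case: z => n; rewrite /pos_part ?pickle_Posz ?pickle_Negz chead_code ?chead0 //.
by rewrite chead_code.
Qed.

Definition cell_code N (i : 'I_N) (y : nat) : nat :=
  chead (ctail (chead (iter (index (i, i) (enum {: 'I_N * 'I_N})) ctail (chead y)))).

Lemma cell_codeE N (i : 'I_N) (A : gaussQ N) :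
  cell_code i (pickle A) = pickle (A.1 i i).
Proof.
have ii : (index (i, i) (enum {: 'I_N * 'I_N}) < size (enum {: 'I_N * 'I_N}))%N.
  by rewrite index_mem mem_enum.
rewrite /cell_code pickle_gaussQ chead_code pickle_mx chead_iter_code; last by rewrite size_map.
by rewrite (nth_map (i, i)) // nth_index ?mem_enum // ctail_code chead_code.
Qed.

(** The comparison of [2 ^- k] with a fraction, cleared of denominators. A negative numerator is
    read as 0, which correctly makes the test fail. *)
Definition cell_gt N (i : 'I_N) (y k : nat) : bool :=
  (pos_part (chead (ctail (cell_code i y))) <
     pos_part (chead (cell_code i y)) * 2 ^ k)%N.

Lemma cell_gtE N (i : 'I_N) (A : gaussQ N) k :
  cell_gt i (pickle A) k = (2 ^- k < A.1 i i).
Proof.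
rewrite /cell_gt cell_codeE; set q := A.1 i i.
rewrite pickle_rat ctail_code !chead_code !pos_partE.
rewrite -[q in RHS]divq_num_den; have := denq_gt0 q.
case: (denq q) => // d d0; rewrite ltr_pdivlMr ?ltr0z // mulrC.
rewrite -(@ltr_pM2r _ (2 ^+ k)) ?exprn_gt0 // mulfVK ?expf_neq0 //.
case: (numq q) => n; first by rewrite -!pmulrn -natrX -natrM ltr_nat.
rewrite mul0n ltn0 NegzE mulrNz mulNr; apply/esym/negbTE; rewrite -leNgt.
by rewrite (@le_trans _ _ 0) ?oppr_le0 ?mulr_ge0 ?exprn_ge0 ?ler0z.
Qed.

Lemma decides_cell_gt N (i : 'I_N) k G H :
  computable k G -> computable k H -> decides k (fun xs => cell_gt i (G xs) (H xs)).
Proof.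
move=> cG cH; rewrite /cell_gt /pos_part /cell_code.
set r := index _ _; comp.
Qed.

(** Rationals are stored in lowest terms, so producing the code of a quotient requires a computable
    gcd. *)
Lemma pickle_ratio (a b : nat) : (0 < b)%N ->
  pickle (a%:R / b%:R : rat) =
  CodeSeq.code [:: CodeSeq.code [:: CodeSeq.code [:: (a %/ gcdn a b)%N]; 0%N];
                   CodeSeq.code [:: CodeSeq.code [:: (b %/ gcdn a b)%N]; 0%N]].
Proof.
move=> b0; set g := gcdn a b.
have g0 : (0 < g)%N by rewrite gcdn_gt0 b0 orbT.
have b'0 : (0 < b %/ g)%N by rewrite divn_gt0 // dvdn_leq // dvdn_gcdr.
have E : a%:R / b%:R = ((a %/ g)%N%:Z)%:~R / ((b %/ g)%N%:Z)%:~R :> rat.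
  apply/eqP; rewrite -!pmulrn eqr_div ?pnatr_eq0 -?lt0n // -!natrM eqr_nat.
  by rewrite muln_divA ?dvdn_gcdr // divn_mulAC ?dvdn_gcdl.
have cop : coprime `|Posz (a %/ g)| `|Posz (b %/ g)|.
  by rewrite /= /coprime -(eqn_pmul2r g0) mul1n muln_gcdl !divnK ?dvdn_gcdl ?dvdn_gcdr.
rewrite pickle_rat E coprimeq_num // coprimeq_den //.
have -> : (Posz (b %/ g) == 0) = false by apply/eqP => -[] ?; lia.
by rewrite gtr0_sg ?ltz_nat // mul1r.
Qed.

Lemma computable_scalar_mx N k G H : computable k G -> computable k H ->
  (forall xs, 0 < H xs)%N ->
  computable k (fun xs =>
    pickle ((((G xs)%:R / (H xs)%:R : rat)%:M, 0) : gaussQ N)).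
Proof.
move=> cG cH H0.
have cr : computable k (fun xs => pickle ((G xs)%:R / (H xs)%:R : rat)).
  apply: (computable_ext (fun xs _ => pickle_ratio (G xs) (H0 xs))).
  have cg := computable_gcd cG cH H0.
  do !apply: (@computable_code k [:: _; _]) || apply: (@computable_code k [:: _])
    || split => //; comp.
apply: (@computable_code k [:: (fun xs => pickle ((G xs)%:R / (H xs)%:R)%:M);
  (fun xs => pickle (0 : 'M[rat]_N))]).
split; last by split=> //; comp.
have := @computable_code k [seq (fun xs => CodeSeq.code [:: pickle ij;
   pickle ((((G xs)%:R / (H xs)%:R)%:M : 'M[rat]_N) ij.1 ij.2)])
                          | ij <- enum {: 'I_N * 'I_N}].
move=> cR; apply: computable_ext (cR _) => [xs _|].
  by rewrite pickle_mx -map_comp.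
apply/All_map/All_seq => -[i j] _ /=.
apply: (@computable_code k [:: (fun=> pickle (i, j)); (fun xs =>
   pickle ((((G xs)%:R / (H xs)%:R)%:M : 'M[rat]_N) i j))]).
split; first by comp.
split=> //; have [ij|ij] := eqVneq i j.
  by apply: computable_ext cr => xs _; rewrite mxE ij eqxx mulr1n.
apply: computable_ext (computable_const k (pickle (0 : rat))) => xs _.
by rewrite mxE (negbTE ij).
Qed.

(** * Algorithmic probability *)

Definition prefix_free_seq (L : seq bstring) : Prop :=
  {in L &, forall p q, prefix p q -> p = q}.

(** Induction on a strict bound for the lengths. The empty word can only occur alone; otherwise the
    words are split by their first bit, and dropping it leaves two prefix-free families, each
    contributing at most one half. *)
Lemma kraft (K : realFieldType) (L : seq bstring) :
  uniq L -> prefix_free_seq L -> \sum_(p <- L) (2 : K) ^- size p <= 1.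
Proof.
have [n] : exists n, {in L, forall p, (size p < n)%N}.
  exists (\max_(p <- L) size p).+1 => p pL; rewrite ltnS.
  exact: (@leq_bigmax_seq _ _ xpredT).
elim: n L => [|n IH] L szL uL pf.
  by case: L szL {uL pf} => [_|p L /(_ p (mem_head _ _))] //; rewrite big_nil.
have [nilL|nilL] := boolP ([::] \in L).
  have -> : L = [:: [::]].
    case: L uL nilL pf {szL} => [//|p [|q L]] uL nL pf.
      by move: nL; rewrite inE => /eqP <-.
    have p0 := pf _ _ nL (mem_head _ _) (prefix0s _).
    have q0 : [::] = q by apply: pf => //; rewrite ?prefix0s // !inE eqxx orbT.
    by move: uL; rewrite -p0 -q0.
  by rewrite big_seq1 /= expr0 invr1.
pose part (b : bool) := [seq behead p | p <- L & ohead p == Some b].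
have partE b p : p \in part b -> b :: p \in L.
  move=> /mapP[[|c r]]; rewrite mem_filter //= => /andP[/eqP[->] rL] -> //.
have half b : \sum_(p <- L | ohead p == Some b) (2 : K) ^- size p <= 2^-1.
  have -> : \sum_(p <- L | ohead p == Some b) (2 : K) ^- size p =
      2^-1 * \sum_(p <- part b) 2 ^- size p.
    rewrite big_map big_filter mulr_sumr; apply: eq_bigr => -[|c p] //= _.
    by rewrite exprS invfM.
  rewrite -[leRHS]mulr1 ler_pM2l ?invr_gt0 //; apply: IH.
  - by move=> p /partE /szL.
  - rewrite map_inj_in_uniq ?filter_uniq // => -[|c p] [|d q];
      rewrite !mem_filter //= => /andP[/eqP[->] _] /andP[/eqP[->] _] -> //.
  - move=> p q /partE pL /partE qL pq.
    by have := pf _ _ pL qL; rewrite /= eqxx => /(_ pq)[].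
rewrite (bigID (fun p => ohead p == Some true)) /=.
rewrite [leRHS]splitr !div1r lerD //.
(* No word being empty, those that do not begin with [true] begin with [false]. *)
apply: le_trans (half false); rewrite big_seq_cond [leRHS]big_seq_cond.
rewrite le_eqVlt; apply/orP; left; apply/eqP/eq_bigl => -[|[] p] /=.
- by rewrite (negbTE nilL).
- by rewrite andbF.
- by [].
Qed.

Section AlgorithmicProbability.

Variables (R : realType) (U : bstring -> option bstring).
Hypothesis U_prefix_free : prefix_free_dom U.

Lemma program_sum_le1 (L : seq bstring) :
  uniq L -> {in L, forall p, U p <> None} ->
  \sum_(p <- L) (2 : R) ^- size p <= 1.
Proof.
move=> uL UL; apply: kraft => // p q pL qL.
by apply: U_prefix_free; exact: UL.
Qed.

(** [Pu] is the [fine] of an extended sum; only finiteness, here from Kraft's inequality, makes it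
    the value of that sum. *)
Lemma Pu_fin_num s :
  (\esum_(p in [set p : bstring | U p = Some s]) ((2 : R) ^- size p)%:E
     \is a fin_num)%E.
Proof.
rewrite ge0_fin_numE; last by apply: esum_ge0 => p _; rewrite lee_fin.
apply: (@le_lt_trans _ _ 1%E); last by rewrite ltry.
apply: ge_ereal_sup => _ [A [finA AS] <-].
rewrite fsbig_finite // sumEFin lee_fin; apply: program_sum_le1.
  exact: finmap.fset_uniq.
by move=> p; rewrite in_fset_set // inE => /AS /= ->.
Qed.

Lemma Pu_ge (L : seq bstring) s : uniq L -> {in L, forall p, U p = Some s} ->
  \sum_(p <- L) 2 ^- size p <= Pu R U s.
Proof.
move=> uL UL; rewrite -lee_fin /Pu fineK ?Pu_fin_num //.
apply: esum_ge; exists [set` L]%classic.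
  by split; [exact: finite_seq|move=> p /= /UL].
by rewrite -fsbig_seq // sumEFin.
Qed.

Lemma Pu_approx s e : 0 < e -> exists L : seq bstring,
  [/\ uniq L, {in L, forall p, U p = Some s} &
      Pu R U s - e < \sum_(p <- L) 2 ^- size p].
Proof.
move=> e0.
have [_ [A [finA AS] <-]] := ub_ereal_sup_adherent e0 (Pu_fin_num s).
rewrite -/(esum _ _) -(fineK (Pu_fin_num s)) fsbig_finite // sumEFin.
rewrite -EFinB lte_fin => H; exists (finmap.enum_fset (fset_set A)); split=> //.
  exact: finmap.fset_uniq.
by move=> p; rewrite in_fset_set // inE => /AS.
Qed.

Definition strings_below (n : nat) : seq bstring :=
  [seq bits j l | l <- iota 0 n, j <- iota 0 (2 ^ l)].

Lemma strings_below_uniq n : uniq (strings_below n).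
Proof.
apply: allpairs_uniq_dep; [exact: iota_uniq|by move=> l _; exact: iota_uniq|].
move=> x y /allpairsPdep[l [j [_ jl ->]]] /allpairsPdep[l' [j' [_ jl' ->]]] /=.
move: jl jl'; rewrite !mem_iota !add0n /= => jl jl' E.
have ll : l = l' by rewrite -(size_bits j l) E size_bits.
subst l'; suff -> : j = j' by [].
by have := congr1 bval E; rewrite !bval_bits !modn_small.
Qed.

Lemma mem_strings_below n (p : bstring) : (size p < n)%N -> p \in strings_below n.
Proof.
move=> pn; apply/allpairsPdep; exists (size p), (bval p).
by rewrite !mem_iota bits_bval bval_lt pn.
Qed.

Variable eU : recf.
Hypothesis eUP : forall (s : bstring) (y : nat),
  eval eU [:: pickle s] y <-> exists t, U s = Some t /\ y = pickle t.

Definition found (n x : nat) (p : bstring) : bool :=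
  step n eU [:: pickle p] == x.+1.

(** The stage [n] approximation of [Pu], brought to the common denominator [2 ^ n] so that it can be
    computed in natural numbers. *)
Definition numer (n x : nat) : nat :=
  (\sum_(l < n) \sum_(j < 2 ^ l) found n x (bits j l) * 2 ^ (n - l))%N.

Lemma numerE (K : numFieldType) n x : (numer n x)%:R / (2 ^ n)%:R =
  \sum_(p <- strings_below n | found n x p) (2 : K) ^- size p.
Proof.
have io k : iota 0 k = index_iota 0 k by rewrite /index_iota subn0.
rewrite /numer /strings_below natr_sum mulr_suml [RHS]big_mkcond big_allpairs_dep.
rewrite io big_mkord; apply: eq_bigr => l _.
rewrite natr_sum mulr_suml io big_mkord; apply: eq_bigr => j _; rewrite size_bits.
case: ifP => _; last by rewrite mul0n mul0r.
rewrite mul1n !natrX -[X in _ / _ ^+ X](subnK (ltnW (ltn_ord l))) exprD invfM mulrA.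
by rewrite divff ?mul1r // expf_neq0 // pnatr_eq0.
Qed.

Lemma found_program n s p : found n (pickle s) p -> U p = Some s.
Proof.
by move=> /eqP /step_sound /eUP[t [-> /(pcan_inj pickleK) ->]].
Qed.

Lemma program_found s p : U p = Some s ->
  ultimately (fun n => (p \in strings_below n) && found n (pickle s) p).
Proof.
move=> Up; have /step_complete H : eval eU [:: pickle p] (pickle s).
  by apply/eUP; exists s.
have H' : ultimately (fun n => size p < n)%N by exists (size p).+1.
apply: ultimately_impl (ultimately_and H H') => n [E pn].
by rewrite mem_strings_below //= /found E.
Qed.

Lemma numer_le n s : (numer n (pickle s))%:R / (2 ^ n)%:R <= Pu R U s.
Proof.
rewrite numerE -big_filter; apply: Pu_ge; first exact/filter_uniq/strings_below_uniq.
by move=> p; rewrite mem_filter => /andP[/found_program].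
Qed.

(** A finite family of programs already carries [Pu] up to [e], and from some stage on all its
    members have been found; [numer_le] bounds the other side. *)
Lemma numer_cvg s :
  (((numer n (pickle s))%:R / (2 ^ n)%:R : R) @[n --> \oo] --> Pu R U s)%classic.
Proof.
apply/cvgrPdist_lt => e e0; have [L [uL UL PL]] := Pu_approx s e0.
have [n0 Hn0] : ultimately (fun n =>
    all (fun p => (p \in strings_below n) && found n (pickle s) p) L).
  elim: L UL {uL PL} => [|p L IH] UL; first by exists 0%N.
  have Up := program_found (UL p (mem_head _ _)).
  have {}/IH IH : {in L, forall p, U p = Some s}.
    by move=> q qL; apply: UL; rewrite inE qL orbT.
  by apply: ultimately_impl (ultimately_and Up IH) => n /= [-> ->].
exists n0 => // n /= /Hn0 /allP Ln.
rewrite ger0_norm ?subr_ge0 ?numer_le // ltrBlDr -ltrBlDl.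
apply: lt_le_trans PL _; rewrite numerE -[leRHS]big_filter; apply: ler_sum_subset => //.
- exact/filter_uniq/strings_below_uniq.
- by move=> p /Ln; rewrite mem_filter andbC.
Qed.

(** [U] is single-valued, so a program is found for at most one string and the sums merge into a
    single Kraft sum over distinct programs. *)
Lemma numer_sum_le1 n (S : seq bstring) : uniq S ->
  \sum_(s <- S) ((numer n (pickle s))%:R / (2 ^ n)%:R : R) <= 1.
Proof.
move=> uS.
have -> : \sum_(s <- S) ((numer n (pickle s))%:R / (2 ^ n)%:R : R) =
    \sum_(p <- [seq p <- strings_below n | has (fun s => found n (pickle s) p) S])
       2 ^- size p.
  rewrite big_filter; elim: S uS => [_|s S IH /= /andP[sS /IH {}IH]].
    by rewrite big_nil big_pred0.
  rewrite big_cons IH numerE [RHS](bigID (found n (pickle s))) /=.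
  congr (_ + _); apply: eq_bigl => p.
    by case: (found n (pickle s) p); rewrite ?andbF.
  case F: (found n (pickle s) p); rewrite ?andbF ?andbT //=.
  apply/negP => /hasP[t tS Ft]; move: sS.
  by have := found_program F; rewrite (found_program Ft) => -[<-]; rewrite tS.
apply: program_sum_le1; first exact/filter_uniq/strings_below_uniq.
by move=> p; rewrite mem_filter => /andP[/hasP[s _ /found_program ->]].
Qed.

Lemma Pu_sum_le1 (S : seq bstring) : uniq S -> \sum_(s <- S) Pu R U s <= 1.
Proof.
move=> uS; have cv : (\sum_(s <- S) ((numer n (pickle s))%:R / (2 ^ n)%:R : R)
    @[n --> \oo] --> \sum_(s <- S) Pu R U s)%classic.
  elim: S {uS} => [|s S IH].
    by rewrite big_nil; under eq_fun do rewrite big_nil; exact: cvg_cst.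
  rewrite big_cons; under eq_fun do rewrite big_cons.
  by apply: cvgD => //; exact: numer_cvg.
apply: (cvgr_to_le cv); apply: nearW => n; exact: numer_sum_le1.
Qed.

Lemma computable_numer :
  computable 2 (fun xs => numer (nth 0%N xs 0) (nth 0%N xs 1)).
Proof.
have cs k G H : computable k G -> computable k H ->
    computable k (fun xs => step (G xs) eU [:: H xs]).
  apply: (@computable_apply2 k (fun n x => step n eU [:: x])).
  by apply: computable_ext (computable_step eU 1) => -[|a [|b []]].
pose g j l xs := ((step (nth 0 xs 0) eU [:: pickle (bits j l)] ==
  (nth 0 xs 1).+1) * 2 ^ (nth 0 xs 0 - l))%N.
apply: (@computable_sum 2 (fun l xs => \sum_(j < 2 ^ l) g j l xs)%N); last by comp.
apply: (@computable_sum 3 (fun j ys => g j (nth 0%N ys 0) (behead ys))); last by comp.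
by rewrite /g; apply: computable_mul; [apply: decides_eq; [apply: cs|]|]; comp.
Qed.

End AlgorithmicProbability.

(** * Positive semi-definite matrices *)

Section PositiveSemidefinite.

Variables (R : realType) (N : nat).
Local Open Scope sesquilinear_scope.
Implicit Types A B : 'M[R[i]]_N.

Lemma form_rowE (P : 'M[R[i]]_N) A i :
  (row i P *m A *m (row i P) ^t*) 0 0 = (P *m A *m P ^t*) i i.
Proof.
transitivity ((row i (P *m A) *m P ^t*) 0 i); last by rewrite -row_mul mxE.
rewrite row_mul [LHS]mxE [RHS]mxE; apply: eq_bigr => k _; congr (_ * _).
by rewrite !mxE.
Qed.

Lemma psd_diag_ge0 A i : psd A -> 0 <= A i i.
Proof.
by move=> [_ /(_ (row i 1%:M))]; rewrite form_rowE mul1mx trmx1 map_mx1 mulmx1.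
Qed.

Lemma psd_spectral A : psd A -> exists (P : 'M[R[i]]_N) (d : 'rV[R[i]]_N),
  [/\ P *m P ^t* = 1%:M, A = P ^t* *m diag_mx d *m P & forall i, 0 <= d 0 i].
Proof.
move=> [hA pA]; set P := spectralmx A; set d := spectral_diag A.
have uP : P \is unitarymx := spectral_unitarymx A.
have PP : P *m P ^t* = 1%:M by apply/unitarymxP.
have AE : A = P ^t* *m diag_mx d *m P.
  have /orthomx_spectralP : A \is normalmx by apply/normalmxP; rewrite hA.
  by rewrite invmx_unitary.
exists P, d; split=> // i; have := pA (row i P); rewrite form_rowE.
suff -> : P *m A *m P ^t* = diag_mx d by rewrite mxE eqxx mulr1n.
by rewrite AE !mulmxA PP mul1mx -mulmxA PP mulmx1.
Qed.

Lemma trace_spectral (P : 'M[R[i]]_N) (d : 'rV[R[i]]_N) B :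
  \tr (P ^t* *m diag_mx d *m P *m B) =
  \sum_i d 0 i * (row i P *m B *m (row i P) ^t*) 0 0.
Proof.
rewrite -!mulmxA mxtrace_mulC -!mulmxA; apply: eq_bigr => i _.
by rewrite mul_diag_mx mxE form_rowE !mulmxA.
Qed.

Lemma trace_psd_ge0 A B : psd A -> psd B -> 0 <= \tr (A *m B).
Proof.
move=> /psd_spectral[P [d [_ -> d0]]] [_ pB]; rewrite trace_spectral.
by apply: sumr_ge0 => i _; rewrite mulr_ge0.
Qed.

(** The eigenvalues of [rho] are nonnegative with sum 1, hence each is at most 1. In an eigenbasis
    of [rho] they weight the diagonal values of [B], whose unweighted sum is the trace of [B]. *)
Lemma trace_density_le (rho : 'M[R[i]]_N) B :
  density rho -> psd B -> \tr (rho *m B) <= \tr B.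
Proof.
move=> [_ [/psd_spectral[P [d [PP rhoE d0]]] tr1]] [_ pB].
have sd : \sum_i d 0 i = 1.
  rewrite -tr1 rhoE -mulmxA mxtrace_mulC -mulmxA PP mulmx1.
  by apply: eq_bigr => i _; rewrite mxE eqxx mulr1n.
have d1 i : d 0 i <= 1.
  by rewrite -sd (bigD1 i) //= lerDl sumr_ge0.
have -> : \tr B = \sum_i (row i P *m B *m (row i P) ^t*) 0 0.
  rewrite -[B in LHS]mulmx1 -(mulmx1C PP) mulmxA mxtrace_mulC mulmxA.
  by apply: eq_bigr => i _; rewrite form_rowE.
rewrite rhoE trace_spectral; apply: ler_sum => i _.
by rewrite -[leRHS]mul1r ler_wpM2r.
Qed.

Lemma hermitian_scalar (x : R) : Defs.hermitian ((x%:C)%C%:M : 'M[R[i]]_N).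
Proof.
rewrite /Defs.hermitian tr_scalar_mx map_scalar_mx /=; congr (_%:M).
by apply: conj_Creal; rewrite realE -[0]/((0 : R)%:C)%C !lecR -realE num_real.
Qed.

Lemma psd_scalar (x : R) : 0 <= x -> psd ((x%:C)%C%:M : 'M[R[i]]_N).
Proof.
move=> x0; split; first exact: hermitian_scalar.
move=> v; rewrite mul_mx_scalar -scalemxAl mxE; apply: mulr_ge0.
  by rewrite -[0]/((0 : R)%:C)%C lecR.
by rewrite mxE sumr_ge0 // => i _; rewrite !mxE mul_conjC_ge0.
Qed.

End PositiveSemidefinite.

Lemma toC_scalar (R : realType) N (q : rat) :
  toC R ((q%:M, 0) : gaussQ N) = ((ratr q)%:C)%C%:M.
Proof.
apply/matrixP => i j; rewrite !mxE /= rmorph0.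
by case: (i == j); rewrite ?mulr1n ?mulr0n ?rmorph0.
Qed.

Lemma Pu_lower_computable (R : realType) N (U : bstring -> option bstring) :
  computer U ->
  lower_computable (fun s => ((Pu R U s)%:C)%C%:M : 'M[R[i]]_N).
Proof.
move=> [[e eP] pf].
pose a n (s : bstring) : rat := (numer e n (pickle s))%:R / (2 ^ n)%:R.
have aE n s : ratr (a n s) = (numer e n (pickle s))%:R / (2 ^ n)%:R :> R.
  by rewrite /a fmorph_div /= !ratr_nat.
have P0 s : 0 <= Pu R U s.
  by have := @Pu_ge R U pf [::] s isT; rewrite big_nil; apply.
split.
  split=> [s|S uS]; rewrite /loewner ?subr0; first exact: psd_scalar.
  have -> : \sum_(s <- S) ((Pu R U s)%:C)%C%:M =
      ((\sum_(s <- S) Pu R U s)%:C)%C%:M :> 'M[R[i]]_N.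
    by rewrite rmorph_sum raddf_sum.
  rewrite -[1%:M](_ : ((1 : R)%:C)%C%:M = _) // -raddfB -rmorphB.
  by apply: psd_scalar; rewrite subr_ge0; exact: (Pu_sum_le1 _ pf eP).
exists (fun n s => ((a n s)%:M, 0)); split; last split; last split.
- have [f Hf] : computable 2 (fun xs => pickle ((((numer e (nth 0%N xs 0)
     (nth 0%N xs 1))%:R / (2 ^ nth 0%N xs 0)%:R : rat)%:M, 0) : gaussQ N)).
    apply: computable_scalar_mx; first exact: computable_numer.
      by comp.
    by move=> xs; rewrite expn_gt0.
  by exists f => n s; exact: (Hf [:: n; pickle s]).
- by move=> n s; rewrite toC_scalar; exact: hermitian_scalar.
- move=> s i j; split; last first.
    rewrite mxE; under eq_fun do rewrite toC_scalar mxE.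
    by case: (i == j); exact: cvg_cst.
  rewrite mxE; under eq_fun do rewrite toC_scalar mxE aE.
  case: (i == j); last exact: cvg_cst.
  exact: (numer_cvg pf eP).
- move=> n s; rewrite /loewner toC_scalar -raddfB -rmorphB.
  by apply: psd_scalar; rewrite subr_ge0 aE; exact: (numer_le _ pf eP).
Qed.

(** * Programs *)

(** The existence of a program excludes the default value 0 of [Kc]. *)
Lemma KcP (U : bstring -> option bstring) s : (exists p, U p = Some s) ->
  (exists2 p, U p = Some s & size p = Kc U s) /\
  (forall p, U p = Some s -> (Kc U s <= size p)%N).
Proof.
move=> [p Up]; rewrite /Kc; case: pselect => [h|[]]; last first.
  by exists (size p); apply/asboolP; exists p.
case: ex_minnP => k /asboolP[q [sq Uq]] kmin; split; first by exists q.
by move=> r Ur; apply: kmin; apply/asboolP; exists r.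
Qed.

Lemma sum_pow2V_le1 (K : realFieldType) (s : seq nat) :
  uniq s -> \sum_(k <- s) (2 : K) ^- k.+1 <= 1.
Proof.
move=> us; pose B := (\max_(k <- s) k).+1.
apply: (@le_trans _ _ (\sum_(k <- iota 0 B) (2 : K) ^- k.+1)).
  apply: ler_sum_subset; rewrite ?iota_uniq // => k ks.
  by rewrite mem_iota /= add0n ltnS (@leq_bigmax_seq _ _ xpredT id).
suff -> : \sum_(k <- iota 0 B) (2 : K) ^- k.+1 = 1 - 2 ^- B.
  by rewrite gerBl invr_ge0 exprn_ge0.
elim: B => [|n IH]; first by rewrite big_nil expr0 invr1 subrr.
rewrite -[n.+1]addn1 iotaD big_cat /= big_seq1 IH add0n addn1.
by rewrite [X in 1 - X]pow2V_halve opprD addrA subrK.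
Qed.

(** The coding theorem is applied to a computable semi-measure that is positive on every string, so
    that every string receives a program. *)
Lemma optimal_surjective (R : realType) (U : bstring -> option bstring) :
  optimal U -> forall s, exists p, U p = Some s.
Proof.
move=> hU; pose m (s : bstring) : R := 2 ^- (pickle s).+1.
pose cond (n : nat) (s : bstring) (k : nat) := ((pickle s).+1 < k)%N.
have mE s k : 2 ^- k < m s <-> exists n, cond n s k.
  rewrite /m ltf_pV2 ?posrE ?exprn_gt0 // ltr_eXn2l ?ltr1n //.
  by split=> [h|[]//]; exists 0%N.
have [|S uS||//|c Hc] := coding_theorem hU (m := m) (cond := cond).
- by move=> s; rewrite invr_ge0 exprn_ge0.
- rewrite -(big_map pickle xpredT (fun k => 2 ^- k.+1)); apply: sum_pow2V_le1.
  by rewrite map_inj_uniq //; exact: pcan_inj pickleK.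
- have [e He] : decides 3 (fun xs => (nth 0 xs 1).+1 < nth 0 xs 2)%N by comp.
  by exists e => n s k; exact: (He [:: n; pickle s; k]).
move=> s; have [|p [Up _]] := Hc s (pickle s).+2; last by exists p.
by apply/mE; exists 0%N; rewrite /cond.
Qed.

Lemma diag_complexity (R : realType) N (U : bstring -> option bstring)
    (M : bstring -> 'M[R[i]]_N) (i : 'I_N) : optimal U -> lower_computable M ->
  exists c : nat, forall s,
    complex.Re (M s i i) <= 2 ^+ c * 2 ^- Kc U s.
Proof.
move=> hU [[M0 M1] [f [[ef Hef] [_ [fcv fM]]]]].
have psdM s : psd (M s) by have := M0 s; rewrite /loewner subr0.
pose m s : R := complex.Re (M s i i).
have m0 s : 0 <= m s.
  by have := psd_diag_ge0 i (psdM s); rewrite lecE /= => /andP[].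
have m_sum S : uniq S -> \sum_(s <- S) m s <= 1.
  move=> /M1 /(psd_diag_ge0 i); rewrite !mxE eqxx summxE lecE /= => /andP[_].
  by rewrite raddfB /= raddf_sum /= subr_ge0.
pose cond n (s : bstring) k : bool := 2 ^- k < (f n s).1 i i.
have condE n s k : cond n s k = (2 ^- k < (ratr ((f n s).1 i i) : R)).
  rewrite /cond -(ltr_rat R); congr (_ < _).
  by rewrite fmorphV rmorphXn /= ratr_nat.
have [e He] : exists e, forall n s k, eval e [:: n; pickle s; k] (cond n s k).
  have [g Hg] : decides 2 (fun xs => cell_gt i (nth 0%N xs 0) (nth 0%N xs 1)).
    by apply: decides_cell_gt; comp.
  exists (RComp g [:: RComp ef [:: RProj 0; RProj 1]; RProj 2]) => n s k.
  rewrite /cond -cell_gtE; apply: (eComp _ (Hg [:: pickle (f n s); k] erefl)).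
  apply: esCons; last by apply: esCons; [exact: (@eProj 2)|exact: esNil].
  apply: (eComp _ (Hef n s)); apply: esCons; first exact: (@eProj 0).
  by apply: esCons; [exact: (@eProj 1)|exact: esNil].
have mE s k : 2 ^- k < m s <-> exists n, cond n s k.
  split=> [km|[n]].
    (* Convergence of [f] supplies a time for every true inequality; in the other direction
       [f n s <= M s] forbids false ones. *)
    have [cv _] := fcv s i i.
    have [n /= Hn] := filter_ex (cvgr_gt _ cv _ km).
    by exists n; rewrite condE; move: Hn; rewrite mxE.
  rewrite condE => /lt_le_trans; apply.
  have := psd_diag_ge0 i (fM n s); rewrite !mxE lecE /= => /andP[_].
  by rewrite raddfB /= subr_ge0.
have [c Hc] := coding_theorem hU m0 m_sum (ex_intro _ e He) mE.
(* One more than the constant of the coding theorem: a violation of the bound would give, at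
   [k = Kc U s - c.+1], a program of length at most [Kc U s - 1]. When [Kc U s <= c.+1] this
   subtraction is useless, but the bound follows from [m s <= 1]. *)
exists c.+1 => s; have [_ Kmin] := KcP (optimal_surjective R hU s).
have m1 : m s <= 1 by have := m_sum [:: s] isT; rewrite big_seq1.
have [Kc_le|cK] := leqP (Kc U s) c.+1.
  apply: le_trans m1 _; rewrite ler_pdivlMr ?exprn_gt0 // mul1r.
  by rewrite ler_eXn2l ?ltr1n.
rewrite leNgt; apply/negP => lt_m.
have [|p [Up sp]] := Hc s (Kc U s - c.+1)%N; last first.
  by have := leq_trans (Kmin _ Up) sp; lia.
apply: le_lt_trans lt_m; rewrite -[in leRHS](subnK (ltnW cK)) exprD invfM.
by rewrite mulrCA divff ?mulr1 // expf_neq0.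
Qed.

Lemma log2_bound (R : realType) (x a b : R) (k : nat) : 0 < a -> 0 < b ->
  a * 2 ^- k <= x -> x <= b * 2 ^- k ->
  `| k%:R + log2 x | <= `|log2 a| + `|log2 b|.
Proof.
move=> a0 b0 ax xb; have l2 : 0 < ln (2 : R) by rewrite ln_gt0 // ltr1n.
have k0 : 0 < (2 : R) ^- k by rewrite invr_gt0 exprn_gt0.
have x0 : 0 < x by apply: lt_le_trans ax; rewrite mulr_gt0.
have lk (y : R) : 0 < y -> log2 (y * 2 ^- k) = log2 y - k%:R.
  move=> y0; rewrite /log2 lnM ?posrE // lnV ?posrE ?exprn_gt0 // lnXn //.
  by rewrite mulrBl -[ln 2 *+ k]mulr_natl mulfK // gt_eqF.
have lmono (y z : R) : 0 < y -> y <= z -> log2 y <= log2 z.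
  move=> y0 yz; rewrite /log2 ler_pM2r ?invr_gt0 // ler_ln ?posrE //.
  exact: lt_le_trans yz.
have h1 := lmono _ _ (mulr_gt0 a0 k0) ax; have h2 := lmono _ _ x0 xb.
rewrite !lk // in h1 h2.
have := ler_norm (- log2 a); have := ler_norm (log2 b); rewrite normrN.
have := normr_ge0 (log2 a); have := normr_ge0 (log2 b).
by rewrite ler_norml => *; apply/andP; split; lra.
Qed.

(** * Assembly of the three comparisons *)

Theorem mainTheorem9 (R : realType) (N : nat) (hN : (0 < N)%N)
    (U : bstring -> option bstring) (hU : optimal U)
    (M : bstring -> 'M[R[i]]_N) (hM : universal M) :
  exists (c c' : R), 0 <= c /\ 0 < c' /\
    forall (rho : 'M[R[i]]_N) (s : bstring), density rho ->
      `| (Kc U s)%:R + log2 (complex.Re (\tr (rho *m M s))) | <= c /\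
      ((c'%:C)%C * ((Pu R U s)%:C)%C <= \tr (rho *m M s) :> R[i]) /\
      ((c'%:C)%C * \tr (rho *m M s) <= ((Pu R U s)%:C)%C :> R[i]).
Proof.
have [lM uM] := hM; have [cU _] := hU.
have [a [a0 Ha]] := uM _ (Pu_lower_computable R N cU).
have /choice[c Hc] : forall i, exists c : nat, forall s,
    complex.Re (M s i i) <= 2 ^+ c * 2 ^- Kc U s.
  by move=> i; exact: diag_complexity.
(* The trace of [M s] is the sum of the diagonal entries, so their constants add up; [hN] makes the
   sum nonempty and [b] positive. *)
pose b : R := \sum_i 2 ^+ c i.
have b0 : 0 < b.
  rewrite /b (bigD1 (Ordinal hN)) //=; apply: ltr_pwDl; first exact: exprn_gt0.
  by apply: sumr_ge0 => i _; exact: exprn_ge0.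
have c'0 : 0 < Num.min a b^-1 by rewrite lt_min a0 invr_gt0.
exists (`|log2 a| + `|log2 b|), (Num.min a b^-1); split; first exact: addr_ge0.
split=> // rho s hrho.
have [M0 _] := lM; have psdM : psd (M s) by have := M0.1 s; rewrite /loewner subr0.
have [_ [prho tr1]] := hrho.
set P := Pu R U s; set x := complex.Re (\tr (rho *m M s)).
(* The trace is a nonnegative element of [R[i]], hence real, so nothing is lost in taking its real
   part. *)
have xE : \tr (rho *m M s) = (x%:C)%C.
  have := trace_psd_ge0 prho psdM; rewrite lecE /x /= => /andP[/eqP im0 _].
  by apply/eqP; rewrite eq_complex /= eqxx im0 eqxx.
have [[p Up sp] Kmin] := KcP (optimal_surjective R hU s).
have KP : 2 ^- Kc U s <= P.
  have := @Pu_ge R U cU.2 [:: p] s isT; rewrite big_seq1 sp; apply.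
  by move=> q; rewrite inE => /eqP ->.
(* The inequality [a P(s) I <= M(s)] is traced against [rho], and [tr1] turns the left side into
   [a * P]. *)
have aP : a * P <= x.
  have := trace_psd_ge0 prho (Ha s); rewrite mulmxBr raddfB /= subr_ge0.
  rewrite -scalemxAr mxtraceZ mul_mx_scalar mxtraceZ tr1 mulr1 xE -rmorphM /=.
  by rewrite lecR.
have xb : x <= b * 2 ^- Kc U s.
  have := trace_density_le hrho psdM; rewrite xE lecE => /andP[_] /=.
  move=> /le_trans; apply; rewrite /mxtrace raddf_sum /b mulr_suml.
  by apply: ler_sum => i _; exact: Hc.
have P0 : 0 <= P by apply: le_trans KP; rewrite invr_ge0 exprn_ge0.
have x0 : 0 <= x by apply: le_trans aP; rewrite mulr_ge0 // ltW.
split.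
  by apply: log2_bound => //; apply: le_trans aP; rewrite ler_pM2l.
rewrite xE -!rmorphM /= !lecR; split.
  by apply: le_trans aP; rewrite ler_wpM2r // ge_min lexx.
apply: le_trans KP; apply: (@le_trans _ _ (b^-1 * x)).
  by rewrite ler_wpM2r // ge_min lexx orbT.
by rewrite ler_pdivrMl.
Qed.
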